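(* Let $M$ be a finite right Fountain monoid and $k$ a field. Suppose that: (1) the characteristic of $k$ divides the order of no maximal subgroup of $M$; (2) $k$ is a splitting field for each maximal subgroup of $M$; (3) for every idempotent $a\in E(M)$ and every simple $kG_a$-module $Y$, the coinduced module $\mathrm{Coind}_{G_a}(Y)$ is a simple $kM$-module. Let $e,f\in E(M)$, let $W$ be a simple $kG_f$-module and $V$ a simple $kG_e$-module. Then the number of arrows in the quiver of $kM$ from the isomorphism class of $\mathrm{Coind}_{G_e}(V)$ to the isomorphism class of $\mathrm{Coind}_{G_f}(W)$ is the multiplicity of $W\otimes D(V)$ as an irreducible constituent in the $k[G_f\times G_e]$-module $f\,\mathrm{rad}(k\widetilde L_e)/fI(f)\,\mathrm{rad}(k\widetilde L_e)$.
   Context: $E(M)$ is the set of idempotents of $M$. $R_e=\{m\in M: mM=eM\}$. For $e\in E(M)$, $G_e$ is the group of units of $eMe$ (the maximal subgroup at $e$). $k$ is a splitting field for a group $G$ if every simple $kG$-module has endomorphism algebra $k$. $m\,\widetilde{\mathcal L}\,n$ iff for all $a\in E(M)$: $ma=m\iff na=n$; $\widetilde L_m$ is the $\widetilde{\mathcal L}$-class of $m$. $M$ is right Fountain if every $\widetilde{\mathcal L}$-class contains an idempotent. $k\widetilde L_e$ is a left $kM$-module via $m\cdot x=mx$ if $mx\in\widetilde L_e$, and $0$ otherwise; for $M$ finite right Fountain, $G_e$ acts on the right of $\widetilde L_e$ by right multiplication, so $k\widetilde L_e$ is a $kM$-$kG_e$-bimodule. $\mathrm{rad}(k\widetilde L_e)$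 is the radical (intersection of maximal submodules) as a left $kM$-module; it is a sub-bimodule. For $f\in E(M)$, $I(f)=\{m\in M: f\notin MmM\}$, and for a $kM$-module $U$, $I(f)U$ is the span of all $mu$ with $m\in I(f)$, $u\in U$; $fI(f)U=f\cdot(I(f)U)$. The quotient $f\,\mathrm{rad}(k\widetilde L_e)/fI(f)\,\mathrm{rad}(k\widetilde L_e)$ is a $kG_f$-$kG_e$-bimodule, hence a left $k[G_f\times G_e]$-module via $(g,h)u=guh^{-1}$. $D(V)=\mathrm{Hom}_k(V,k)$ is a right $kG_e$-module, and $W\otimes D(V)$ (over $k$) is a left $k[G_f\times G_e]$-module via $(g,h)(w\otimes\phi)=gw\otimes\phi h^{-1}$. $kR_e$ is a $kG_e$-$kM$-bimodule: $G_e$ acts by left multiplication, and $r\cdot m=rm$ if $rm\in R_e$, $0$ otherwise. $\mathrm{Coind}_{G_e}(V)=\mathrm{Hom}_{kG_e}(kR_e,V)$ with $(m\varphi)(r)=\varphi(rm)$. Given (1), condition (3) is equivalent to each of: every sandwich matrix of each regular $\mathcal J$-class $J_a$ is right invertible over $kG_a$; for each $a\in E(M)$ and simple $kG_a$-module $Y$, the projective cover of the simple module $\mathrm{Soc}(\mathrm{Coind}_{G_a}(Y))$ is $k\widetilde L_a\otimes_{kG_a}Y$. The quiver of a finite dimensional split $k$-algebra $A$ has vertices the isomorphism classes $[S]$ of simple $A$-modules and $\dim\mathrm{Ext}^1_A(S,S')$ arrows from $[S]$ to $[S']$. *)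

(* Defs.v *)
From HB Require Import structures.
From mathcomp Require Import all_boot all_order all_algebra all_fingroup.
From mathcomp Require Import boolp.

Set Implicit Arguments.
Unset Strict Implicit.
Unset Printing Implicit Defensive.

Import GroupScope GRing.Theory.
Local Open Scope ring_scope.

(* A fresh mixin is used because HB does not accept a join of Monoid and      *)
(* Finite below the existing FinStarMonoid; every finMonoidType is then       *)
(* a monoidType, so the group_scope notations 1, x * y, x ^+ n apply.         *)
HB.mixin Record isFinMonoid M of Finite M := {
  fmul : M -> M -> M;
  fone : M;
  fmulA : associative fmul;
  fmul1 : left_id fone fmul;
  fmulr1 : right_id fone fmul
}.

#[short(type="finMonoidType")]
HB.structure Definition FinMonoid := {M of Finite M & isFinMonoid M}.

HB.instance Definition _ (M : finMonoidType) :=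
  isMonoid.Build (FinMonoid.sort M) fmulA fmul1 fmulr1.

Section VspaceOf.
Variables (k : fieldType) (V : vectType k).

(* The vspace with membership predicate A, when A is a linear subspace.       *)
Definition vspace_of (A : V -> Prop) : {vspace V} :=
  if pselect (exists U : {vspace V}, forall v, v \in U <-> A v) is left h
  then sval (cid h) else 0%VS.

Lemma vspace_ofP (A : V -> Prop) :
  A 0 -> (forall c u v, A u -> A v -> A (c *: u + v)) ->
  forall v, v \in vspace_of A <-> A v.
Proof.
move=> A0 AL; rewrite /vspace_of; case: pselect => [h|nh]; first exact: (svalP (cid h)).
case: nh.
pose P d := `[< exists U : {vspace V}, (forall v, v \in U -> A v) /\ \dim U = d >].
have exP : exists d, P d.
  exists 0%N; apply/asboolP; exists 0%VS; rewrite dimv0; split=> // v.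
  by rewrite memv0 => /eqP->.
have ubP d : P d -> (d <= \dim {:V})%N.
  by move=> /asboolP[U [_ <-]]; apply/dimvS/subvf.
case: (ex_maxnP exP ubP) => d /asboolP[U [UA dU]] dmax.
exists U => v; split=> [/UA//|Av].
have : P (\dim (U + <[v]>)%VS).
  apply/asboolP; exists (U + <[v]>)%VS; split=> // w.
  case/memv_addP=> u uU [x /vlineP[c ->] ->].
  by rewrite addrC; apply: AL => //; apply: UA.
move/dmax; rewrite -dU => le_dim.
have /eqP-> : U == (U + <[v]>)%VS by rewrite eqEdim addvSl.
by apply: (subvP (addvSr _ _)); apply: memv_line.
Qed.

End VspaceOf.

Notation freevect k X := {ffun X -> k^o}.

Section FreeVect.
Variables (k : fieldType) (X : finType).

Definition bas (x : X) : freevect k X := [ffun y => (y == x)%:R].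

Lemma freevectE (F : freevect k X) : F = \sum_x (F x : k) *: bas x.
Proof.
apply/ffunP=> y; rewrite sum_ffunE (bigD1 y) //= !ffunE eqxx /=.
rewrite big1 ?addr0; first by rewrite /GRing.scale /= mulr1.
by move=> x neq_xy; rewrite !ffunE eq_sym (negPf neq_xy) scaler0.
Qed.

Variable V : vectType k.

Definition lext_fun (g : X -> V) (F : freevect k X) : V :=
  \sum_x (F x : k) *: g x.

Lemma lext_fun_is_linear g : linear (lext_fun g).
Proof.
move=> c F F'; rewrite /lext_fun scaler_sumr -big_split /=.
by apply: eq_bigr => x _; rewrite !ffunE scalerDl scalerA.
Qed.
HB.instance Definition _ g :=
  GRing.isSemilinear.Build k (freevect k X) V *:%R (lext_fun g)
    (GRing.semilinear_linear (lext_fun_is_linear g)).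

Definition lext (g : X -> V) : 'Hom(freevect k X, V) := linfun (lext_fun g).

Lemma lext_bas g x : lext g (bas x) = g x.
Proof.
rewrite lfunE /= /lext_fun (bigD1 x) //= ffunE eqxx scale1r big1 ?addr0 //.
by move=> y neq; rewrite ffunE (negPf neq) scale0r.
Qed.

Lemma lext_eq (f g : 'Hom(freevect k X, V)) :
  (forall x, f (bas x) = g (bas x)) -> f = g.
Proof.
move=> fg; apply/lfunP=> F; rewrite (freevectE F) !linear_sum /=.
by apply: eq_bigr => x _; rewrite !linearZ /= fg.
Qed.

End FreeVect.

Section Tensor.
Variables (k : fieldType).
Implicit Types W U : vectType k.

Local Notation e W := (vbasis {:W}).

(* A concrete tensor product over k : with respect to the bases vbasis {:W}   *)
(* and vbasis {:U}, the matrix X stands for \sum_(i, j) X i j (e_i (x) e_j).  *)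
Definition tens W U := 'M[k]_(\dim {:W}, \dim {:U}).
HB.instance Definition _ W U := Vector.on (tens W U).

Definition ptens W U (w : W) (u : U) : tens W U :=
  \matrix_(i, j) (coord (e W) i w * coord (e U) j u).

Definition ptensr W U (u : U) (w : W) := ptens w u.

Lemma ptens_linearl W U (u : U) : linear (@ptensr W U u).
Proof.
by move=> c w w'; apply/matrixP=> i j; rewrite !mxE linearP /= mulrDl mulrA.
Qed.

Lemma ptens_linearr W U (w : W) : linear (fun u : U => ptens w u).
Proof.
move=> c u u'; apply/matrixP=> i j.
by rewrite !mxE linearP /= mulrDr mulrCA.
Qed.
HB.instance Definition _ W U u :=
  GRing.isSemilinear.Build k W (tens W U) *:%R (@ptensr W U u)
    (GRing.semilinear_linear (@ptens_linearl W U u)).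
HB.instance Definition _ W U w :=
  GRing.isSemilinear.Build k U (tens W U) *:%R (@ptens W U w)
    (GRing.semilinear_linear (@ptens_linearr W U w)).

Lemma ptens_basis W U (i : 'I_(\dim {:W})) (j : 'I_(\dim {:U})) :
  ptens (e W)`_i (e U)`_j = delta_mx i j :> tens W U.
Proof.
apply/matrixP=> a b; rewrite !mxE !coord_free ?(basis_free (vbasisP _)) //.
by rewrite -natrM mulnb ![_ == a]eq_sym ![_ == b]eq_sym.
Qed.

Definition tmap_fun W U (f : 'End(W)) (g : 'End(U)) (X : tens W U) : tens W U :=
  \sum_i \sum_j X i j *: ptens (f (e W)`_i) (g (e U)`_j).

Lemma tmap_fun_is_linear W U f g : linear (@tmap_fun W U f g).
Proof.
move=> c X Y; rewrite /tmap_fun scaler_sumr -big_split; apply: eq_bigr => i _ /=.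
rewrite scaler_sumr -big_split; apply: eq_bigr => j _ /=.
by rewrite !mxE scalerDl scalerA.
Qed.
HB.instance Definition _ W U f g :=
  GRing.isSemilinear.Build k (tens W U) (tens W U) *:%R (@tmap_fun W U f g)
    (GRing.semilinear_linear (@tmap_fun_is_linear W U f g)).

Definition tmap W U (f : 'End(W)) (g : 'End(U)) : 'End(tens W U) :=
  linfun (tmap_fun f g).

Lemma tmapE W U (f : 'End(W)) (g : 'End(U)) w u :
  tmap f g (ptens w u) = ptens (f w) (g u).
Proof.
rewrite lfunE /= /tmap_fun.
rewrite -[RHS]/(ptensr _ _) [w in RHS](coord_vbasis (memvf w)) !linear_sum /=.
apply: eq_bigr => i _; rewrite !linearZ /= /ptensr.
rewrite [u in RHS](coord_vbasis (memvf u)) !linear_sum /=.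
by apply: eq_bigr => j _; rewrite mxE !linearZ /= scalerA mulrC.
Qed.

Lemma tmap_eq W U (f g : 'End(tens W U)) :
  (forall w u, f (ptens w u) = g (ptens w u)) -> f = g.
Proof.
move=> fg; apply/lfunP=> X; rewrite (matrix_sum_delta X) !linear_sum.
apply: eq_bigr => i _; rewrite !linear_sum; apply: eq_bigr => j _.
by rewrite !linearZ -ptens_basis /= fg.
Qed.

End Tensor.

(* A finite dimensional left kM-module, given as a k-space with a k-linear    *)
(* left action of M. Simple modules of finite monoids are of this kind.       *)
Record kmod (k : fieldType) (M : monoidType) := KMod {
  carrier :> vectType k;
  act : M -> 'End(carrier);
  act1 : act 1%g = \1%VF;
  actM : forall x y, act (x * y)%g = (act x \o act y)%VF
}.

Arguments act {k M N} m : rename.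
Arguments act1 {k M} N : rename.
Arguments actM {k M} N x y : rename.

Section Modules.
Variables (k : fieldType) (M : monoidType).
Implicit Types N P : kmod k M.

Definition is_hom N P (f : 'Hom(N, P)) := forall m v, f (act m v) = act m (f v).

Lemma is_hom_sub N P :
  @is_hom N P 0 /\
  forall c (f g : 'Hom(N, P)), is_hom f -> is_hom g -> is_hom (c *: f + g).
Proof.
split=> [m v|c f g hf hg m v]; first by rewrite !lfunE /= linear0.
by rewrite !(add_lfunE, scale_lfunE) hf hg linearP.
Qed.

Definition homs N P : {vspace 'Hom(N, P)} := vspace_of (@is_hom N P).

Lemma memv_homs N P f : f \in homs N P <-> is_hom f.
Proof. by have [? ?] := is_hom_sub N P; apply: vspace_ofP. Qed.

Definition isomorphic N P :=
  exists f : 'Hom(N, P), [/\ is_hom f, lker f = 0%VS & limg f = fullv].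

Definition submod N (U : {vspace N}) := forall m, (act m @: U <= U)%VS.

Definition simple_mod N :=
  (fullv : {vspace N}) != 0%VS /\
  forall U : {vspace N}, submod U -> U = 0%VS \/ U = fullv.

Definition maximal_submod N (U : {vspace N}) :=
  [/\ submod U, U != fullv &
      forall W : {vspace N}, submod W -> (U <= W)%VS -> W = U \/ W = fullv].

Definition rad N : {vspace N} :=
  vspace_of (fun v => forall U, maximal_submod U -> v \in U).

Lemma memv_rad N v : v \in rad N <-> forall U, maximal_submod U -> v \in U.
Proof.
apply: vspace_ofP => [U _|c u w hu hw U mU]; first exact: mem0v.
by rewrite memvD ?memvZ ?hu ?hw.
Qed.

Lemma rad_submod N : submod (rad N).
Proof.
move=> m; apply/subvP=> _ /memv_imgP[v /memv_rad hv ->].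
apply/memv_rad => U mU; have [hU _ _] := mU.
by apply: (subvP (hU m)); apply: memv_img; apply: hv.
Qed.

Lemma rad_aut N (f f' : 'End(N)) :
  is_hom f -> is_hom f' -> cancel f f' -> cancel f' f ->
  (f @: rad N <= rad N)%VS.
Proof.
move=> hf hf' fK f'K; apply/subvP=> _ /memv_imgP[v /memv_rad hv ->].
apply/memv_rad => U [hU nU mU]; rewrite memv_preim; apply: hv.
have memT v' : (v' \in (f @^-1: U)%VS) = (f v' \in U) by rewrite memv_preim.
split.
- move=> m; apply/subvP=> _ /memv_imgP[w wT ->]; rewrite memT hf.
  by apply: (subvP (hU m)); apply: memv_img; rewrite -memT.
- apply: contra nU => /eqP Tf; rewrite eqEsubv subvf; apply/subvP=> w _.
  by rewrite -(f'K w) -memT Tf memvf.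
move=> W hW TW.
have [] := mU (f @: W)%VS.
- move=> m; apply/subvP=> _ /memv_imgP[_ /memv_imgP[w wW ->] ->].
  by rewrite -hf; apply: memv_img; apply: (subvP (hW m)); apply: memv_img.
- apply/subvP=> w wU; rewrite -(f'K w); apply: memv_img; apply: (subvP TW).
  by rewrite memT f'K.
- move=> fWU; left; apply/vspaceP=> w; rewrite memT -fWU.
  by apply/idP/memv_imgP=> [wW|[w' w'W /(can_inj fK)->//]]; exists w.
- move=> fWf; right; apply/vspaceP=> w; rewrite memvf.
  have /memv_imgP[w' w'W /(can_inj fK)->//] : f w \in (f @: W)%VS.
  by rewrite fWf memvf.
Qed.

(* The identity of a simple N being nonzero, this says End_{kM}(N) = k.       *)
Definition splitting_field :=
  forall N, simple_mod N ->
  forall f : 'End(N), is_hom f -> exists c : k, f = c *: \1%VF.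

Section Restriction.
Variables (V : vectType k) (U : {vspace V}) (a : M -> 'End(V)).

Definition restr (f : 'End(V)) : 'End(subvs_of U) :=
  (linfun (vsproj U) \o f \o linfun vsval)%VF.

Lemma restrE f u : (f @: U <= U)%VS -> vsval (restr f u) = f (vsval u).
Proof.
move=> fU; rewrite !comp_lfunE !lfunE /= vsprojK //.
by apply: (subvP fU); apply: memv_img; apply: subvsP.
Qed.

Hypothesis aU : forall m, (a m @: U <= U)%VS.
Hypothesis a1 : {in U, a 1%g =1 id}.
Hypothesis aM : forall x y, {in U, forall u, a (x * y)%g u = a x (a y u)}.

Fact restr1 : restr (a 1%g) = \1%VF.
Proof. by apply/lfunP=> u; apply/val_inj; rewrite /= restrE // a1 ?subvsP ?lfunE. Qed.

Fact restrM x y : restr (a (x * y)%g) = (restr (a x) \o restr (a y))%VF.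
Proof.
apply/lfunP=> u; apply/val_inj; rewrite /= comp_lfunE !restrE //.
by rewrite aM ?subvsP // restrE.
Qed.

(* U is only required to be stable under the maps a m, and a to be an action  *)
(* on U, not on V.                                                            *)
Definition restr_mod : kmod k M := KMod restr1 restrM.
End Restriction.

Section Sub.
Variables (N : kmod k M) (U : {vspace N}) (hU : submod U).

Fact sub_act1 : {in U, act (1%g : M) =1 @id N}.
Proof. by move=> u _; rewrite act1 lfunE. Qed.

Fact sub_actM x y : {in U, forall u : N, act (x * y)%g u = act x (act y u)}.
Proof. by move=> u _; rewrite actM lfunE. Qed.

Definition sub_mod : kmod k M := restr_mod hU sub_act1 sub_actM.

Lemma sub_actE m (u : sub_mod) : vsval (act m u) = act m (vsval u) :> N.
Proof. by apply: restrE; apply: hU. Qed.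

(* N/U is carried by a linear complement of U.                               *)
Definition quo_space : vectType k := subvs_of (U^C)%VS.

Definition quo_proj : 'Hom(N, quo_space) :=
  (linfun (vsproj (U^C)%VS) \o daddv_pi (U^C)%VS U)%VF.

Definition quo_act (m : M) : 'End(quo_space) :=
  (quo_proj \o act m \o linfun vsval)%VF.

Lemma val_quo_proj v : vsval (quo_proj v) = daddv_pi (U^C)%VS U v.
Proof. by rewrite comp_lfunE lfunE /= vsprojK ?memv_pi. Qed.

Lemma quo_projB v : v - vsval (quo_proj v) \in U.
Proof.
rewrite val_quo_proj.
have cU : (U^C :&: U = 0)%VS by rewrite capvC capv_compl.
have : v \in (U^C + U)%VS by rewrite addvC addv_complf memvf.
move/(daddv_pi_add cU) => {1}<-.
by rewrite addrAC subrr add0r memv_pi.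
Qed.

Lemma quo_proj_val w : quo_proj (vsval w) = w.
Proof.
apply/val_inj; rewrite /= val_quo_proj daddv_pi_id ?subvsP //.
by rewrite capvC capv_compl.
Qed.

Lemma quo_proj_ker : lker quo_proj = U.
Proof.
apply/vspaceP=> v; rewrite memv_ker; apply/eqP/idP=> [pv0|vU].
  have := quo_projB v; rewrite pv0.
  by rewrite (_ : vsval 0 = 0) // subr0.
apply/val_inj; rewrite /= val_quo_proj; apply/eqP; rewrite -memv0.
have cU : (U^C :&: U = 0)%VS by rewrite capvC capv_compl.
rewrite -cU memv_cap memv_pi /= -[X in X \in U](subKr v) memvB //.
by rewrite -val_quo_proj quo_projB.
Qed.

Lemma quo_proj_img : limg quo_proj = fullv.
Proof.
apply/eqP; rewrite eqEsubv subvf; apply/subvP=> w _.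
by rewrite -(quo_proj_val w) memv_img ?memvf.
Qed.

Lemma quo_actE m v : quo_act m (quo_proj v) = quo_proj (act m v).
Proof.
have -> w : quo_act m w = quo_proj (act m (vsval w)).
  by rewrite /quo_act (comp_lfunE _ _ w) (comp_lfunE quo_proj) (lfunE (vsval (U:=_))).
apply/eqP; rewrite -subr_eq0 -linearB -memv_ker /=.
rewrite quo_proj_ker -linearB /=; apply: (subvP (hU m)); apply: memv_img.
by rewrite -opprB memvN quo_projB.
Qed.

Fact quo_act1 : quo_act 1%g = \1%VF.
Proof.
by apply/lfunP=> w; rewrite -(quo_proj_val w) quo_actE act1 !lfunE.
Qed.

Fact quo_actM x y : quo_act (x * y)%g = (quo_act x \o quo_act y)%VF.
Proof.
apply/lfunP=> w; rewrite -(quo_proj_val w) quo_actE actM comp_lfunE.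
by rewrite (comp_lfunE (quo_act x)) !quo_actE.
Qed.

Definition quo_mod : kmod k M := KMod quo_act1 quo_actM.
End Sub.

(* comp_factors N s : s lists the factors of a composition series of N, from  *)
(* the top                                                                    *)
Inductive comp_factors : kmod k M -> seq (kmod k M) -> Prop :=
| CompNil N : (fullv : {vspace N}) = 0%VS -> comp_factors N [::]
| CompCons N (U : {vspace N}) (hU : submod U) s :
    simple_mod (quo_mod hU) -> comp_factors (sub_mod hU) s ->
    comp_factors N (quo_mod hU :: s).

Lemma comp_factors_ex N : exists s, comp_factors N s.
Proof.
have [n] := ubnP (\dim {:N}); elim: n N => // n IHn N ltNn.
have [N0|Nn0] := eqVneq (fullv : {vspace N}) 0%VS.
  by exists [::]; apply: CompNil.
pose P d := `[< exists U : {vspace N}, [/\ submod U, U != fullv & \dim U = d] >].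
have exP : exists d, P d.
  exists 0%N; apply/asboolP; exists 0%VS; split; rewrite ?dimv0 1?eq_sym //.
  by move=> m; rewrite limg0.
have ubP d : P d -> (d <= \dim {:N})%N.
  by move=> /asboolP[U [_ _ <-]]; apply/dimvS/subvf.
case: (ex_maxnP exP ubP) => d /asboolP[U [hU neqU dU]] dmax.
have ltUN : (\dim U < \dim {:N})%N.
  by rewrite ltnNge; apply: contra neqU => le; rewrite eqEdim subvf.
have [|s hs] := IHn (sub_mod hU).
  by rewrite dimvf; apply: leq_trans ltUN _.
exists (quo_mod hU :: s); apply: CompCons => //.
have prK (W : {vspace quo_mod hU}) :
    W = (quo_proj U @: (quo_proj U @^-1: W))%VS.
  by rewrite lpreimK // quo_proj_img subvf.
split.
  apply: contra neqU => /eqP q0; rewrite -(quo_proj_ker U) eqEsubv subvf /=.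
  apply/subvP=> v _; rewrite memv_ker -memv0 -q0; exact: memvf.
move=> W hW.
set T := (quo_proj U @^-1: W)%VS.
have hT : submod T.
  move=> m; apply/subvP=> _ /memv_imgP[v vT ->].
  rewrite -memv_preim -(quo_actE hU); apply: (subvP (hW m)).
  by apply: memv_img; rewrite memv_preim.
have UT : (U <= T)%VS.
  apply/subvP=> v; rewrite -{1}(quo_proj_ker U) memv_ker -memv_preim.
  by move=> /eqP->; apply: mem0v.
have [Tf|Tnf] := eqVneq T fullv.
  by right; rewrite (prK W) -/T Tf quo_proj_img.
left; have /dmax leT : P (\dim T) by apply/asboolP; exists T.
have /eqP TU : U == T by rewrite eqEdim UT dU.
by rewrite (prK W) -/T -TU; apply/eqP; rewrite -lkerE quo_proj_ker.
Qed.

Definition factors N : seq (kmod k M) := sval (cid (comp_factors_ex N)).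

Lemma factorsP N : comp_factors N (factors N).
Proof. by rewrite /factors; case: cid. Qed.

(* Multiplicity of X as a composition factor of N; by the Jordan-Hoelder      *)
(* theorem it does not depend on the composition series chosen by factors.    *)
Definition mult X N : nat := count (fun Y => `[< isomorphic X Y >]) (factors N).

End Modules.

Section Free.
Variables (k : fieldType) (M : finMonoidType) (V : vectType k).

(* The free module kM (x)_k V is realized as the space of functions M -> V,   *)
(* with fgen m v standing for m (x) v.                                        *)
Definition fgen (m : M) (v : V) : {ffun M -> V} :=
  [ffun x => if x == m then v else 0].

Lemma fgen_is_linear m : linear (fgen m).
Proof.
move=> c u v; apply/ffunP=> x; rewrite !ffunE; case: eqP => // _.
by rewrite scaler0 addr0.
Qed.
HB.instance Definition _ m :=
  GRing.isSemilinear.Build k V {ffun M -> V} *:%R (fgen m)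
    (GRing.semilinear_linear (fgen_is_linear m)).

Lemma fgen_sum (F : {ffun M -> V}) : F = \sum_x fgen x (F x).
Proof.
apply/ffunP=> y; rewrite sum_ffunE (bigD1 y) //= !ffunE eqxx big1 ?addr0 //.
by move=> x neq; rewrite ffunE eq_sym (negPf neq).
Qed.

Section Ext.
Variables (P : vectType k) (b : M -> 'Hom(V, P)).

Definition fext_fun (F : {ffun M -> V}) : P := \sum_x b x (F x).

Lemma fext_fun_is_linear : linear fext_fun.
Proof.
move=> c F F'; rewrite /fext_fun scaler_sumr -big_split; apply: eq_bigr => x _.
by rewrite !ffunE linearP.
Qed.
HB.instance Definition _ :=
  GRing.isSemilinear.Build k {ffun M -> V} P *:%R fext_fun
    (GRing.semilinear_linear fext_fun_is_linear).

Definition fext : 'Hom({ffun M -> V}, P) := linfun fext_fun.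

Lemma fextE m v : fext (fgen m v) = b m v.
Proof.
rewrite lfunE /= /fext_fun (bigD1 m) //= ffunE eqxx big1 ?addr0 //.
by move=> x neq; rewrite ffunE (negPf neq) linear0.
Qed.
End Ext.

Lemma fhom_eq (P : vectType k) (f g : 'Hom({ffun M -> V}, P)) :
  (forall m v, f (fgen m v) = g (fgen m v)) -> f = g.
Proof.
move=> fg; apply/lfunP=> F; rewrite (fgen_sum F) !linear_sum.
by apply: eq_bigr => x _; apply: fg.
Qed.

Definition free_act (m : M) : 'End({ffun M -> V}) :=
  fext (fun x => linfun (fgen (m * x)%g)).

Lemma free_actE m x v : free_act m (fgen x v) = fgen (m * x)%g v.
Proof. by rewrite fextE lfunE. Qed.

Fact free_act1 : free_act 1%g = \1%VF.
Proof. by apply: fhom_eq => x v; rewrite free_actE mul1g id_lfunE. Qed.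

Fact free_actM x y : free_act (x * y)%g = (free_act x \o free_act y)%VF.
Proof. by apply: fhom_eq => z v; rewrite comp_lfunE !free_actE mulgA. Qed.

Definition free_mod : kmod k M := KMod free_act1 free_actM.

Lemma act_fgen m x v : act m (fgen x v : free_mod) = fgen (m * x)%g v.
Proof. exact: free_actE. Qed.

Definition free_lift (P : kmod k M) (b : 'Hom(V, P)) : 'Hom(free_mod, P) :=
  fext (fun x => act x \o b)%VF.

Lemma free_liftE (P : kmod k M) (b : 'Hom(V, P)) m v :
  free_lift b (fgen m v) = act m (b v).
Proof. by rewrite fextE comp_lfunE. Qed.

Lemma free_lift_hom (P : kmod k M) (b : 'Hom(V, P)) : is_hom (free_lift b).
Proof.
move=> m F; rewrite -!comp_lfunE; congr (fun_of_lfun _ F).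
apply: fhom_eq => x v.
by rewrite !comp_lfunE free_actE !free_liftE actM comp_lfunE.
Qed.

Lemma free_mod_projective (P Q : kmod k M) (p : 'Hom(P, Q))
    (h : 'Hom(free_mod, Q)) :
  is_hom p -> limg p = fullv -> is_hom h ->
  exists h' : 'Hom(free_mod, P), is_hom h' /\ (p \o h')%VF = h.
Proof.
move=> hp pf hh.
exists (free_lift (p^-1 \o h \o linfun (fgen 1%g))%VF).
split; first exact: free_lift_hom.
apply: fhom_eq => m v; rewrite comp_lfunE free_liftE hp !comp_lfunE.
by rewrite limg_lfunVK ?pf ?memvf // -hh (lfunE (fgen 1%g)) act_fgen mulg1.
Qed.

End Free.

Section Ext1.
Variables (k : fieldType) (M : finMonoidType).
Implicit Types S : kmod k M.

Definition counit S : 'Hom(free_mod M S, S) := free_lift \1%VF.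

Lemma counit_hom S : is_hom (counit S).
Proof. exact: free_lift_hom. Qed.

Lemma counit_img S : limg (counit S) = fullv.
Proof.
apply/eqP; rewrite eqEsubv subvf; apply/subvP=> s _.
have <- : counit S (fgen 1%g s) = s by rewrite free_liftE act1 !id_lfunE.
by apply: memv_img; apply: memvf.
Qed.

Fact syz_submod S : submod (lker (counit S)).
Proof.
move=> m; apply/subvP=> _ /memv_imgP[v vK ->]; rewrite memv_ker counit_hom.
by move: vK; rewrite memv_ker => /eqP->; rewrite linear0.
Qed.

Definition syz S : kmod k M := sub_mod (@syz_submod S).

(* The free resolution  ... -> free (syz (syz S)) -> free (syz S) -> free S   *)
(* of S : syz_diff S maps free (syz S) onto the kernel syz S of counit S.     *)
Definition syz_diff S : 'Hom(free_mod M (syz S), free_mod M S) :=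
  (linfun vsval \o counit (syz S))%VF.

Lemma syz_diffE S F : syz_diff S F = vsval (counit (syz S) F).
Proof. by rewrite comp_lfunE lfunE. Qed.

Section Precomp.
Variables (U V W : vectType k) (d : 'Hom(U, V)).

Definition precomp_fun (f : 'Hom(V, W)) : 'Hom(U, W) := (f \o d)%VF.

Lemma precomp_fun_is_linear : linear precomp_fun.
Proof. by move=> c f g; rewrite /precomp_fun comp_lfunDl comp_lfunZl. Qed.
HB.instance Definition _ :=
  GRing.isSemilinear.Build k 'Hom(V, W) 'Hom(U, W) *:%R precomp_fun
    (GRing.semilinear_linear precomp_fun_is_linear).

Definition precomp : 'Hom('Hom(V, W), 'Hom(U, W)) := linfun precomp_fun.

Lemma precompE f : precomp f = (f \o d)%VF.
Proof. by rewrite lfunE. Qed.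
End Precomp.

(* Ext^1_{kM}(S, S') is the first cohomology of Hom_{kM}(-, S') applied to    *)
(* the above free resolution of S.                                            *)
Definition ext1_cocycles S S' : {vspace 'Hom(free_mod M (syz S), S')} :=
  (homs (free_mod M (syz S)) S' :&: lker (precomp S' (syz_diff (syz S))))%VS.

Definition ext1_coboundaries S S' : {vspace 'Hom(free_mod M (syz S), S')} :=
  (precomp S' (syz_diff S) @: homs (free_mod M S) S')%VS.

Lemma ext1_sub S S' : (ext1_coboundaries S S' <= ext1_cocycles S S')%VS.
Proof.
apply/subvP=> _ /memv_imgP[f /memv_homs hf ->]; rewrite memv_cap.
have hom_d T : is_hom (syz_diff T).
  by move=> m F; rewrite !syz_diffE counit_hom sub_actE.
rewrite memv_ker !precompE; apply/andP; split.
  by apply/memv_homs => m v; rewrite (comp_lfunE f) (comp_lfunE f) hom_d hf.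
apply/eqP/lfunP=> F; rewrite comp_lfunE (comp_lfunE f) zero_lfunE syz_diffE.
have := subvsP (counit (syz (syz S)) F); rewrite memv_ker => /eqP u0.
by rewrite syz_diffE u0 !linear0.
Qed.

Definition dim_ext1 S S' : nat :=
  (\dim (ext1_cocycles S S') - \dim (ext1_coboundaries S S'))%N.

(* For S, S' simple, the number of arrows from [S] to [S'] in the quiver of   *)
(* kM; it depends only on the isomorphism classes.                            *)
Definition quiver_arrows S S' : nat := dim_ext1 S S'.

End Ext1.

Section Monoid.
Variable M : finMonoidType.
Implicit Types m n a e f g x y : M.
Local Open Scope group_scope.

Definition idempotent a : bool := a * a == a.

Record idem := Idem { idval :> M; idemP : idempotent idval }.

Definition right_ideal m : {set M} := [set m * x | x : M].
Definition Rclass e : {set M} := [set m | right_ideal m == right_ideal e].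

Definition corner e : {set M} := [set e * x * e | x : M].
Definition maxsub e : {set M} :=
  [set g in corner e | [exists h in corner e, (g * h == e) && (h * g == e)]].

Definition ltilde m n : bool :=
  [forall a, idempotent a ==> ((m * a == m) == (n * a == n))].
Definition Ltilde m : {set M} := [set n | ltilde n m].
Definition right_fountain : Prop := forall m, exists2 a, idempotent a & a \in Ltilde m.

Definition nonabove f : {set M} :=
  [set m : M | ~~ [exists x : M, exists y : M, x * m * y == f]].

Lemma ltildeP m n :
  reflect (forall a, idempotent a -> (m * a = m <-> n * a = n)) (ltilde m n).
Proof.
apply: (iffP forallP) => [h a ia|h a].
  have /implyP/(_ ia)/eqP ha := h a.
  by split=> /eqP; [rewrite ha | rewrite -ha] => /eqP.
apply/implyP=> ia; apply/eqP; have := h a ia => -[h1 h2].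
by apply/eqP/eqP.
Qed.

Section Group.
Variable e0 : idem.
Local Notation e := (idval e0).

Lemma idemE : e * e = e. Proof. exact/eqP/(idemP e0). Qed.

Lemma cornerP x : reflect (e * x = x /\ x * e = x) (x \in corner e).
Proof.
apply: (iffP imsetP) => [[y _ ->]|[ex xe]].
  by rewrite !mulgA idemE -!mulgA idemE.
by exists x; rewrite // ex xe.
Qed.

Lemma maxsubP g :
  reflect [/\ e * g = g, g * e = g &
             exists h, [/\ e * h = h, h * e = h, g * h = e & h * g = e]]
          (g \in maxsub e).
Proof.
rewrite inE; apply: (iffP andP) => [[/cornerP[? ?]] | [? ? [h [? ? ? ?]]]].
  case/exists_inP=> h /cornerP[? ?] /andP[/eqP ? /eqP ?].
  by split=> //; exists h.
split; first exact/cornerP.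
by apply/exists_inP; exists h; [apply/cornerP|apply/andP; split; apply/eqP].
Qed.

Definition maxgrp : Type := {g : M | g \in maxsub e}.
HB.instance Definition _ := SubFinite.on maxgrp.

Fact maxgrp_one_subproof : e \in maxsub e.
Proof. by apply/maxsubP; rewrite idemE; split=> //; exists e; rewrite !idemE. Qed.

Fact maxgrp_mul_subproof (x y : maxgrp) : val x * val y \in maxsub e.
Proof.
have /maxsubP[ex xe [x' [ex' xe' xx' x'x]]] := valP x.
have /maxsubP[ey ye [y' [ey' ye' yy' y'y]]] := valP y.
apply/maxsubP; split; first by rewrite mulgA ex.
  by rewrite -mulgA ye.
exists (y' * x'); split; first by rewrite mulgA ey'.
- by rewrite -mulgA xe'.
- by rewrite -mulgA (mulgA (val y)) yy' ex' xx'.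
- by rewrite -mulgA (mulgA x') x'x ey y'y.
Qed.

Fact maxgrp_inv_subproof (x : maxgrp) :
  exists y : maxgrp, (val y * val x == e) && (val x * val y == e).
Proof.
have /maxsubP[ex xe [x' [ex' xe' xx' x'x]]] := valP x.
have x'G : x' \in maxsub e by apply/maxsubP; split=> //; exists (val x).
by exists (Sub x' x'G : maxgrp); rewrite /= x'x xx' eqxx.
Qed.

Definition maxgrp_one : maxgrp := Sub (e) maxgrp_one_subproof.
Definition maxgrp_mul (x y : maxgrp) : maxgrp :=
  Sub (val x * val y) (maxgrp_mul_subproof x y).
Definition maxgrp_inv (x : maxgrp) : maxgrp := xchoose (maxgrp_inv_subproof x).

Fact maxgrp_mulA : associative maxgrp_mul.
Proof. by move=> x y z; apply/val_inj; rewrite /= mulgA. Qed.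
Fact maxgrp_mul1 : left_id maxgrp_one maxgrp_mul.
Proof. by move=> x; apply/val_inj; have /maxsubP[] := valP x. Qed.
Fact maxgrp_mulV : left_inverse maxgrp_one maxgrp_inv maxgrp_mul.
Proof.
move=> x; apply/val_inj => /=.
by have /andP[/eqP] := xchooseP (maxgrp_inv_subproof x).
Qed.

HB.instance Definition _ :=
  Finite_isGroup.Build maxgrp maxgrp_mulA maxgrp_mul1 maxgrp_mulV.

Lemma val_maxgrp1 : val (1 : maxgrp) = e. Proof. by []. Qed.
Lemma val_maxgrpM (x y : maxgrp) : val (x * y) = val x * val y.
Proof. by []. Qed.
Lemma val_maxgrp_id (x : maxgrp) : e * val x = val x /\ val x * e = val x.
Proof. by have /maxsubP[] := valP x. Qed.

Lemma Ltilde_mulr x : x \in Ltilde e -> x * e = x.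
Proof. by rewrite inE => /ltildeP/(_ _ (idemP e0))[_]; apply; apply: idemE. Qed.

Lemma Ltilde_lcancel m n x :
  x \in Ltilde e -> m * n * x \in Ltilde e -> n * x \in Ltilde e.
Proof.
rewrite !inE => /ltildeP hx /ltildeP hmnx; apply/ltildeP=> a ia.
split=> [nxa|ea]; first by apply/(hmnx a ia); rewrite -!mulgA (mulgA n) nxa.
by rewrite -mulgA (hx a ia).2.
Qed.

Lemma idempotent_power m : exists2 n, (0 < n)%N & idempotent (m ^+ n).
Proof.
pose F (i : 'I_#|M|.+1) := m ^+ i.
have /injectivePn[i [j neq_ij eqF]] : ~~ injectiveb F.
  by apply/negP=> /injectiveP/leq_card; rewrite card_ord ltnn.
wlog ltij : i j neq_ij eqF / (i < j)%N.
  move=> wl; have [lt|lt|/val_inj eq] := ltngtP i j; first exact: (wl i j).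
    by apply: (wl j i); rewrite // eq_sym.
  by rewrite eq eqxx in neq_ij.
pose p := (j - i)%N; have p0 : (0 < p)%N by rewrite subn_gt0.
have per (n : nat) : (i <= n)%N -> m ^+ (n + p) = m ^+ n.
  move=> le; rewrite -(subnK le) -addnA !expgnDr; congr (_ * _).
  by rewrite -expgnDr subnKC ?(ltnW ltij).
have perM (n q : nat) : (i <= n)%N -> m ^+ (n + q * p) = m ^+ n.
  move=> le; elim: q => [|q IHq]; first by rewrite mul0n addn0.
  by rewrite mulSn addnA addnAC per ?IHq // (leq_trans le) ?leq_addr.
exists (i.+1 * p)%N; first by rewrite muln_gt0.
rewrite /idempotent -expgnDr perM //.
by rewrite (leq_trans (leqnSn i)) ?leq_pmulr.
Qed.

(* G_e acts on the right of Ltilde e when M is right Fountain.               *)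
Lemma Ltilde_rmul (HF : right_fountain) x (g : maxgrp) :
  x \in Ltilde e -> x * val g \in Ltilde e.
Proof.
move=> xL; have xe := Ltilde_mulr xL.
have /maxsubP[eg ge [h [eh he gh hg]]] := valP g.
set y := val g in eg ge gh hg *.
have [b ib] := HF (x * y); rewrite inE => /ltildeP hb.
have bb : b * b = b by apply/eqP.
have xyb : x * y * b = x * y by apply/(hb b ib).
have be : b * e = b by apply/(hb e (idemP e0)); rewrite -mulgA ge.
pose u := y * b * h.
have xu : x * u = x by rewrite /u !mulgA xyb -mulgA gh xe.
have [n n0 iun] := idempotent_power u.
have xun i : x * u ^+ i = x.
  by elim: i => [|i IHi]; rewrite ?expg0 ?mulg1 // expgSr mulgA IHi.
have eu : e * u = u by rewrite /u !mulgA eg.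
have un : u ^+ n = e.
  have : e * u ^+ n = e.
    by move: xL; rewrite inE => /ltildeP/(_ _ iun)[h1 _]; apply: h1.
  by case: (n) n0 => // n' _; rewrite expgS mulgA eu.
have [c ec] : exists c, e = c * b.
  exists (h * u ^+ n.-1 * y).
  rewrite -!mulgA (_ : y * b = u * y); last first.
    by rewrite /u -!mulgA hg be.
  by rewrite (mulgA (u ^+ _)) -expgSr prednK // un mulgA he hg.
rewrite inE; apply/ltildeP=> a ia; rewrite -(hb a ia).
split=> [ba|ea]; first by rewrite ec -mulgA ba.
by rewrite -be -mulgA ea.
Qed.

(* R_e is stable under left multiplication by G_e, and its complement in eM   *)
(* is stable under right multiplication by M.                                 *)
Lemma RclassP r :
  reflect ((exists x, e = r * x) /\ e * r = r) (r \in Rclass e).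
Proof.
rewrite inE; apply: (iffP eqP) => [eqR|[[x ex] er]].
  split.
    have : e \in right_ideal r by rewrite eqR; apply/imsetP; exists 1; rewrite ?mulg1.
    by case/imsetP=> x _ ->; exists x.
  have : r \in right_ideal e by rewrite -eqR; apply/imsetP; exists 1; rewrite ?mulg1.
  by case/imsetP=> x _ ->; rewrite mulgA idemE.
apply/setP=> y; apply/imsetP/imsetP=> -[z _ ->].
  by exists (r * z); rewrite // mulgA er.
by exists (x * z); rewrite // mulgA -ex.
Qed.

Lemma Rclass_idl r : r \in Rclass e -> e * r = r.
Proof. by case/RclassP. Qed.

Lemma Rclass_lmul (g : maxgrp) r : r \in Rclass e -> val g * r \in Rclass e.
Proof.
case/RclassP=> -[x ex] er; have /maxsubP[eg ge [h [eh he gh hg]]] := valP g.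
apply/RclassP; split; last by rewrite mulgA eg.
by exists (x * h); rewrite !mulgA -(mulgA (val g)) -ex ge.
Qed.

Lemma Rclass_rcancel r m n :
  r \in Rclass e -> r * m * n \in Rclass e -> r * m \in Rclass e.
Proof.
case/RclassP=> _ er /RclassP[[x ex] _]; apply/RclassP; split.
  by exists (n * x); rewrite mulgA.
by rewrite mulgA er.
Qed.

Lemma Rclass_lcancel (g : maxgrp) r m :
  r \in Rclass e -> val g * (r * m) \in Rclass e -> r * m \in Rclass e.
Proof.
case/RclassP=> _ er /(Rclass_lmul g^-1); rewrite mulgA.
have -> : val g^-1 * val g = e by rewrite -val_maxgrpM mulVg.
by rewrite mulgA er.
Qed.

End Group.
End Monoid.

Arguments idem M : clear implicits.
Arguments right_fountain M : clear implicits.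

Section MonoidModules.
Variables (k : fieldType) (M : finMonoidType).

(* In kA, for A a subset of M : the basis vector y if y is in A, 0 otherwise  *)
Definition pbas (A : {set M}) (y : M) : freevect k {x | x \in A} :=
  if insub y is Some z then bas k z else 0.

Lemma pbas_in (A : {set M}) y (Ay : y \in A) : pbas A y = bas k (Sub y Ay).
Proof. by rewrite /pbas insubT. Qed.

Lemma pbas_val (A : {set M}) (z : {x | x \in A}) : pbas A (val z) = bas k z.
Proof. by rewrite /pbas valK. Qed.

Lemma pbas_notin (A : {set M}) y : y \notin A -> pbas A y = 0.
Proof. by move=> Ay; rewrite /pbas insubN. Qed.

Section Idempotent.
Variable e : idem M.

Notation kL := (freevect k {x | x \in Ltilde e}).
Notation kR := (freevect k {x | x \in Rclass e}).

Definition Ltilde_act (m : M) : 'End(kL) :=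
  lext (fun x => pbas (Ltilde e) (m * val x)%g).

Definition Ltilde_ract (m : M) : 'End(kL) :=
  lext (fun x => pbas (Ltilde e) (val x * m)%g).

Lemma Ltilde_act_pbas m y :
  y \in Ltilde e -> Ltilde_act m (pbas (Ltilde e) y) = pbas (Ltilde e) (m * y)%g.
Proof. by move=> yL; rewrite pbas_in lext_bas. Qed.

Lemma Ltilde_ract_pbas m y :
  y \in Ltilde e -> Ltilde_ract m (pbas (Ltilde e) y) = pbas (Ltilde e) (y * m)%g.
Proof. by move=> yL; rewrite pbas_in lext_bas. Qed.

Fact Ltilde_act1 : Ltilde_act 1%g = \1%VF.
Proof. by apply: lext_eq => x; rewrite lext_bas mul1g pbas_val id_lfunE. Qed.

Fact Ltilde_actM x y : Ltilde_act (x * y)%g = (Ltilde_act x \o Ltilde_act y)%VF.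
Proof.
apply: lext_eq => z; rewrite comp_lfunE !lext_bas.
have [yzL|yzL] := boolP ((y * val z)%g \in Ltilde e).
  by rewrite Ltilde_act_pbas // mulgA.
rewrite (pbas_notin yzL) linear0 pbas_notin //.
by apply: contra yzL; apply: Ltilde_lcancel; apply: valP.
Qed.

Definition Ltilde_mod : kmod k M := KMod Ltilde_act1 Ltilde_actM.

Definition Rclass_act (g : maxgrp e) : 'End(kR) :=
  lext (fun r => pbas (Rclass e) (val g * val r)%g).

Definition Rclass_ract (m : M) : 'End(kR) :=
  lext (fun r => pbas (Rclass e) (val r * m)%g).

Fact Rclass_act1 : Rclass_act 1%g = \1%VF.
Proof.
apply: lext_eq => r; rewrite lext_bas id_lfunE val_maxgrp1.
by rewrite (Rclass_idl (valP r)) pbas_val.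
Qed.

Fact Rclass_actM x y : Rclass_act (x * y)%g = (Rclass_act x \o Rclass_act y)%VF.
Proof.
apply: lext_eq => r; rewrite comp_lfunE !lext_bas.
by rewrite (pbas_in (Rclass_lmul y (valP r))) lext_bas /= mulgA.
Qed.

Definition Rclass_mod : kmod k (maxgrp e) := KMod Rclass_act1 Rclass_actM.

Lemma Rclass_ract1 : Rclass_ract 1%g = \1%VF.
Proof. by apply: lext_eq => x; rewrite lext_bas mulg1 pbas_val id_lfunE. Qed.

Lemma Rclass_ractM x y :
  Rclass_ract (x * y)%g = (Rclass_ract y \o Rclass_ract x)%VF.
Proof.
apply: lext_eq => r; rewrite comp_lfunE !lext_bas.
have [rxR|rxR] := boolP ((val r * x)%g \in Rclass e).
  by rewrite (pbas_in rxR) lext_bas /= mulgA.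
rewrite (pbas_notin rxR) linear0 pbas_notin // mulgA.
by apply: contra rxR; apply: Rclass_rcancel; apply: valP.
Qed.

Lemma Rclass_ract_hom m : @is_hom k (maxgrp e) Rclass_mod Rclass_mod (Rclass_ract m).
Proof.
move=> g F; rewrite -!comp_lfunE; congr (fun_of_lfun _ F).
apply: lext_eq => r; rewrite !comp_lfunE !lext_bas.
rewrite (pbas_in (Rclass_lmul g (valP r))) lext_bas /=.
have [rmR|rmR] := boolP ((val r * m)%g \in Rclass e).
  by rewrite (pbas_in rmR) lext_bas /= mulgA.
rewrite (pbas_notin rmR) linear0 pbas_notin // -mulgA.
by apply: contra rmR; apply: Rclass_lcancel; apply: valP.
Qed.

Section Coind.
Variable V : kmod k (maxgrp e).

(* Hom_k(k R_e, V) with (m phi)(r) = phi (r m)                              *)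
Definition coind_act (m : M) : 'End('Hom(Rclass_mod, V)) :=
  precomp V (Rclass_ract m).

Fact coind_act1 : coind_act 1%g = \1%VF.
Proof.
by apply/lfunP=> f; rewrite precompE Rclass_ract1 comp_lfun1r id_lfunE.
Qed.

Fact coind_actM x y : coind_act (x * y)%g = (coind_act x \o coind_act y)%VF.
Proof.
by apply/lfunP=> f; rewrite comp_lfunE !precompE Rclass_ractM comp_lfunA.
Qed.

Definition Hom_mod : kmod k M := KMod coind_act1 coind_actM.

Fact coind_submod : @submod k M Hom_mod (homs Rclass_mod V).
Proof.
move=> m; apply/subvP=> _ /memv_imgP[f /memv_homs hf ->]; rewrite precompE.
by apply/memv_homs => g F; rewrite !(comp_lfunE f) Rclass_ract_hom hf.
Qed.

Definition Coind : kmod k M := sub_mod coind_submod.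
End Coind.

End Idempotent.

(* W (x) D(V) with (g, h) (w (x) phi) = g w (x) phi h^-1, see tensD_actE      *)
Section TensDual.
Variables (G H : finGroupType) (W : kmod k G) (V : kmod k H).

Definition dual : vectType k := 'Hom(V, k^o).

Definition tensD_act (x : G * H) : 'End(tens W dual) :=
  tmap (act x.1) (precomp k^o (act x.2^-1%g : 'End(V))).

Lemma tensD_actE x w (phi : dual) :
  tensD_act x (ptens w phi) = ptens (act x.1 w) (phi \o act x.2^-1%g)%VF.
Proof. by rewrite tmapE precompE. Qed.

Fact tensD_act1 : tensD_act 1%g = \1%VF.
Proof.
apply: tmap_eq => w phi.
by rewrite tensD_actE invg1 !act1 comp_lfun1r !id_lfunE.
Qed.

Fact tensD_actM x y : tensD_act (x * y)%g = (tensD_act x \o tensD_act y)%VF.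
Proof.
apply: tmap_eq => w phi.
by rewrite comp_lfunE !tensD_actE /= invMg !actM comp_lfunA comp_lfunE.
Qed.

Definition tensD : kmod k (G * H)%type := KMod tensD_act1 tensD_actM.
End TensDual.

(* The k[G_f x G_e]-module f rad(k Ltilde_e) / f I(f) rad(k Ltilde_e)         *)
Section Layer.
Hypothesis HF : right_fountain M.
Variables (e f : idem M).

Local Notation L := (Ltilde_mod e).

Lemma Ltilde_ract1 : Ltilde_ract e (val (1 : maxgrp e)%g) = \1%VF.
Proof.
apply: lext_eq => x.
by rewrite lext_bas val_maxgrp1 (Ltilde_mulr (valP x)) pbas_val id_lfunE.
Qed.

Lemma Ltilde_ractM (g h : maxgrp e) :
  Ltilde_ract e (val (g * h)%g) =
  (Ltilde_ract e (val h) \o Ltilde_ract e (val g))%VF.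
Proof.
apply: lext_eq => x; rewrite comp_lfunE !lext_bas.
by rewrite Ltilde_ract_pbas ?mulgA //; apply: (Ltilde_rmul HF); apply: valP.
Qed.

Lemma Ltilde_ract_hom (g : maxgrp e) : @is_hom k M L L (Ltilde_ract e (val g)).
Proof.
move=> m F; rewrite -!comp_lfunE; congr (fun_of_lfun _ F).
apply: lext_eq => x; rewrite !comp_lfunE !lext_bas.
have xgL := Ltilde_rmul HF g (valP x).
rewrite [RHS]Ltilde_act_pbas //.
have [mxL|mxL] := boolP ((m * val x)%g \in Ltilde e).
  by rewrite Ltilde_ract_pbas // mulgA.
rewrite (pbas_notin mxL) linear0 pbas_notin //; apply: contra mxL => mxgL.
have := Ltilde_rmul HF g^-1%g mxgL.
rewrite -!mulgA -[(val g * val _)%g]val_maxgrpM mulgV val_maxgrp1.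
by rewrite (Ltilde_mulr (valP x)).
Qed.

Lemma Ltilde_ract_rad (g : maxgrp e) :
  (Ltilde_ract e (val g) @: rad L <= rad L)%VS.
Proof.
apply: (rad_aut (Ltilde_ract_hom g) (Ltilde_ract_hom g^-1%g)) => v.
  by rewrite -comp_lfunE -Ltilde_ractM mulgV Ltilde_ract1 id_lfunE.
by rewrite -comp_lfunE -Ltilde_ractM mulVg Ltilde_ract1 id_lfunE.
Qed.

Definition ideal_mul (N : kmod k M) (U : {vspace N}) : {vspace N} :=
  (\sum_(m in nonabove f) (act m @: U))%VS.

Definition f_rad : {vspace L} := (act (f : M) @: rad L)%VS.
Definition fI_rad : {vspace L} := (act (f : M) @: ideal_mul (rad L))%VS.

Definition layer_act (x : maxgrp f * maxgrp e) : 'End(L) :=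
  ((act (val x.1) : 'End(L)) \o Ltilde_ract e (val x.2^-1%g))%VF.

Lemma layer_actC x v :
  layer_act x v = Ltilde_ract e (val x.2^-1%g) (act (val x.1) v).
Proof. by rewrite comp_lfunE Ltilde_ract_hom. Qed.

Fact layer_f x v : layer_act x (act (f : M) v) = act (f : M) (layer_act x v).
Proof.
rewrite !layer_actC -Ltilde_ract_hom; congr (fun_of_lfun _ _).
have [fx xf] := val_maxgrp_id x.1.
have actMv m n w : act (m * n)%g w = act m (act n w) :> L.
  by rewrite actM comp_lfunE.
by rewrite -!actMv fx xf.
Qed.

Fact layer_stable x : (layer_act x @: f_rad <= f_rad)%VS.
Proof.
apply/subvP=> _ /memv_imgP[_ /memv_imgP[v vR ->] ->]; rewrite layer_f.
apply: memv_img; rewrite layer_actC.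
apply: (subvP (Ltilde_ract_rad _)); apply: memv_img.
by apply: (subvP (@rad_submod k M L (val x.1))); apply: memv_img.
Qed.

Fact layer_1 : {in f_rad, layer_act 1%g =1 id}.
Proof.
move=> _ /memv_imgP[v vR ->]; rewrite layer_actC invg1 Ltilde_ract1 id_lfunE.
by rewrite -comp_lfunE -actM val_maxgrp1 idemE.
Qed.

Fact layer_M x y :
  {in f_rad, forall u, layer_act (x * y)%g u = layer_act x (layer_act y u)}.
Proof.
move=> u _; rewrite !layer_actC -Ltilde_ract_hom.
have -> : act (val (x * y)%g.1) u = act (val x.1) (act (val y.1) u) :> L.
  by rewrite -comp_lfunE -actM.
rewrite -[RHS]comp_lfunE -Ltilde_ractM; congr (fun_of_lfun (Ltilde_ract e (val _)) _).
by rewrite -invMg.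
Qed.

Definition f_rad_mod : kmod k (maxgrp f * maxgrp e)%type :=
  restr_mod layer_stable layer_1 layer_M.

Definition fI_rad_sub : {vspace f_rad_mod} :=
  (linfun (vsval (U := f_rad)) @^-1: fI_rad)%VS.

Fact fI_rad_submod : submod fI_rad_sub.
Proof.
move=> x; apply/subvP=> _ /memv_imgP[u uI ->].
have memI w : (w \in fI_rad_sub) = (vsval w \in fI_rad).
  by rewrite -memv_preim lfunE.
rewrite memI in uI; rewrite memI restrE ?layer_stable //.
have /memv_imgP[v vI ->] := uI; rewrite layer_f; apply: memv_img.
have /memv_sumP[w wI ->] := vI.
rewrite linear_sum; apply: memv_suml => m mI.
have /memv_imgP[r rR ->] := wI m mI.
rewrite /= layer_actC.
have -> : act (val x.1) (act m r) = act (val x.1 * m)%g r :> L.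
  by rewrite actM comp_lfunE.
rewrite Ltilde_ract_hom.
apply: (subvP (sumv_sup (val x.1 * m)%g _ (subvv _))); last first.
  by apply: memv_img; apply: (subvP (Ltilde_ract_rad _)); apply: memv_img.
move: mI; rewrite !inE; apply: contra => /existsP[y /existsP[z /eqP yz]].
apply/existsP; exists (y * val x.1)%g; apply/existsP; exists z.
by apply/eqP; rewrite mulgA in yz.
Qed.

Definition rad_layer : kmod k (maxgrp f * maxgrp e)%type := quo_mod fI_rad_submod.

End Layer.

End MonoidModules.

(* Main.v *)
Require Import Defs.
From HB Require Import structures.
From mathcomp Require Import all_boot all_order all_algebra all_fingroup.
From mathcomp Require Import boolp.
(* Brings back act for modules, which the theory of finite groups rebinds. *)
Import Defs.

(** Write S = Coind V, S' = Coind W, L = k Ltilde_e and G = G_e. The module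
    P = L (x)_{kG} V maps onto S, and the theorem says that it behaves like a
    projective cover of S as far as maps to S' are concerned: Ext^1(S, S') is
    Hom(rad P, S'), and rad P = rad L (x)_{kG} V. By adjunction for Coind, a
    homomorphism from rad P to Coind W is a map from
    f rad L / f I(f) rad L to Hom_k(V, W) that commutes with G_f and G_e, and the
    dimension of the space of such maps is the multiplicity of
    Hom_k(V, W) = W (x) D(V), since the order of G_f x G_e is invertible in k
    (Maschke) and Hom_k(V, W) has only scalar endomorphisms.

    No projective cover has to be constructed. P is handled as a quotient of the
    free module F = kM (x) V: for lam in the dual of V, the homomorphism
    Lcoord lam : F -> L sends m (x) v to the average over g in G of
    lam(g v) m g^-1, and the kernel of F -> P consists of the z at which all of
    them vanish (Lnull z). Let cover : F -> S be the natural map and N its kernel,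
    so that N / Lnull is rad P. Three facts carry the proof.

    - Schanuel's lemma (dim_ext1_free): Ext^1(S, S') is Hom(N, S') modulo the
      restrictions of Hom(F, S').

    - Relative projectivity (extend_hom): every homomorphism N -> S' agrees on
      Lnull with one defined on F, which amounts to Ext^1(P, S') = 0. Up to
      averaging, Lnull is spanned by elements y (x) v with y in Me outside
      Ltilde_e. Being right Fountain gives y = y b with b an idempotent having
      the same properties; so if f y = y and y is not in R_f, then y (x) v = y . (b (x) v)
      goes to an element of y Coind W, whose value at f is 0. Nothing thus
      obstructs prescribing the extension by its values on R_f.

    - Rigidity (rigidity): a homomorphism from F to a simple module that vanishes
      on Lnull vanishes on N. Such a simple module has the J-class of e as its
      apex, and r in R_e acts on the image of z through the value at r of
      cover z. Applied to the simple quotients of L this shows that the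
      coordinates of an element of N lie in rad L (Lcoord_rad); applied to S' it
      shows that a map F -> S' killing Lnull restricts to 0 on N.

    Together they give Ext^1(S, S') = {h : N -> S' | h = 0 on Lnull}
    (dim_ext1_relative), and evaluating at f identifies this space with
    Hom(f rad L / f I(f) rad L, Hom_k(V, W)) (dim_killing_homs). *)

Set Implicit Arguments.
Unset Strict Implicit.
Unset Printing Implicit Defensive.

Import GroupScope GRing.Theory.
Local Open Scope ring_scope.

(** * Modules over a monoid *)

Section ModuleTheory.
Variables (k : fieldType) (M : monoidType).
Implicit Types N P Q : kmod k M.

Lemma actMv N x y (v : N) : act (x * y)%g v = act x (act y v).
Proof. by rewrite actM comp_lfunE. Qed.

Lemma act1v N (v : N) : act (1%g : M) v = v.
Proof. by rewrite act1 id_lfunE. Qed.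

Lemma is_hom_comp N P Q (g : 'Hom(P, Q)) (f : 'Hom(N, P)) :
  is_hom g -> is_hom f -> is_hom (g \o f)%VF.
Proof. by move=> hg hf m v; rewrite !comp_lfunE hf hg. Qed.

Lemma is_homD N P (f g : 'Hom(N, P)) : is_hom f -> is_hom g -> is_hom (f + g).
Proof. by move=> hf hg m v; rewrite !add_lfunE hf hg linearD. Qed.

Lemma is_homB N P (f g : 'Hom(N, P)) : is_hom f -> is_hom g -> is_hom (f - g).
Proof.
by move=> hf hg m v; rewrite !(add_lfunE, opp_lfunE) hf hg linearB.
Qed.

Lemma is_hom_id N : is_hom (\1%VF : 'End(N)).
Proof. by move=> m v; rewrite !id_lfunE. Qed.

Lemma quo_proj_hom N (U : {vspace N}) (hU : submod U) :
  @is_hom k M N (quo_mod hU) (quo_proj U).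
Proof. by move=> m v; rewrite [RHS]quo_actE. Qed.

Lemma linfun_vsvalE (A : vectType k) (U : {vspace A}) (u : subvs_of U) :
  linfun vsval u = vsval u.
Proof. by rewrite (lfunE (vsval (U := U))). Qed.

Lemma vsval_hom N (U : {vspace N}) (hU : submod U) :
  @is_hom k M (sub_mod hU) N (linfun vsval).
Proof. by move=> m v; rewrite !linfun_vsvalE sub_actE. Qed.

Lemma submod_act N (U : {vspace N}) m v : submod U -> v \in U -> act m v \in U.
Proof. by move=> hU vU; apply: (subvP (hU m)); apply: memv_img. Qed.

Lemma ker_submod N P (f : 'Hom(N, P)) : is_hom f -> submod (lker f).
Proof.
move=> hf m; apply/subvP=> _ /memv_imgP[v vK ->]; rewrite memv_ker hf.
by move: vK; rewrite memv_ker => /eqP->; rewrite linear0.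
Qed.

Lemma img_submod N P (f : 'Hom(N, P)) : is_hom f -> submod (limg f).
Proof.
move=> hf m; apply/subvP=> _ /memv_imgP[_ /memv_imgP[v _ ->] ->].
by rewrite -hf memv_img ?memvf.
Qed.

(** A simple module is generated by any nonzero vector: to prove a linear,
    M-stable property everywhere it suffices to find one nonzero instance. *)
Lemma simple_ind N (A : N -> Prop) (v : N) : simple_mod N ->
    A 0 -> (forall c u w, A u -> A w -> A (c *: u + w)) ->
    (forall m u, A u -> A (act m u)) ->
  v != 0 -> A v -> forall u, A u.
Proof.
move=> [_ sN] A0 AL AM v0 Av u; have memA := vspace_ofP A0 AL.
have hA : submod (vspace_of A).
  by move=> m; apply/subvP=> _ /memv_imgP[w /memA Aw ->]; apply/memA/AM.
apply/memA; case: (sN _ hA) => [A00|->]; last exact: memvf.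
by move/memA: Av; rewrite A00 memv0 (negPf v0).
Qed.

Lemma simple_hom_inj N P (f : 'Hom(N, P)) :
  simple_mod N -> is_hom f -> f != 0 -> lker f == 0%VS.
Proof.
move=> [_ sN] hf f0; case: (sN _ (ker_submod hf)) => [->//|kf].
by case/eqP: f0; apply/lfunP=> v; rewrite zero_lfunE; apply/eqP; rewrite -memv_ker kf memvf.
Qed.

Lemma simple_hom_surj N P (f : 'Hom(N, P)) :
  simple_mod P -> is_hom f -> f != 0 -> limg f = fullv.
Proof.
move=> [_ sP] hf f0; case: (sP _ (img_submod hf)) => [If|//].
case/eqP: f0; apply/lfunP=> v; rewrite zero_lfunE; apply/eqP.
by rewrite -memv0 -If memv_img ?memvf.
Qed.

Lemma simple_neq0 N : simple_mod N -> exists v : N, v != 0.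
Proof.
move=> [n0 _]; exists (vpick fullv); by rewrite vpick0.
Qed.

Lemma preim_submod N P (f : 'Hom(N, P)) (U : {vspace P}) :
  is_hom f -> submod U -> submod (f @^-1: U)%VS.
Proof.
move=> hf hU m; apply/subvP=> _ /memv_imgP[v vU ->].
by rewrite -memv_preim hf submod_act ?memv_preim.
Qed.

Lemma ker_maximal N P (f : 'Hom(N, P)) :
  simple_mod P -> is_hom f -> f != 0 -> maximal_submod (lker f).
Proof.
move=> sP hf f0; have If := simple_hom_surj sP hf f0; split.
- exact: ker_submod.
- apply: contra f0 => /eqP kf; apply/eqP/lfunP=> v; rewrite zero_lfunE.
  by apply/eqP; rewrite -memv_ker kf memvf.
move=> U hU kU.
have imU : submod (f @: U)%VS.
  move=> m; apply/subvP=> _ /memv_imgP[_ /memv_imgP[v vU ->] ->].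
  by rewrite -hf memv_img ?submod_act.
have [_ /(_ _ imU)[fU|fU]] := sP.
  by left; apply/eqP; rewrite eqEsubv kU lkerE fU eqxx.
right; apply/eqP; rewrite eqEsubv subvf; apply/subvP=> v _.
have /memv_imgP[u uU fvu] : f v \in (f @: U)%VS by rewrite fU memvf.
rewrite -(subrK u v) memvD //; apply: (subvP kU).
by rewrite memv_ker linearB /= fvu subrr.
Qed.

(** The kernel of a nonzero map to a simple module is a maximal submodule. *)
Lemma rad_hom0 N P (f : 'Hom(N, P)) v :
  simple_mod P -> is_hom f -> v \in rad N -> f v = 0.
Proof.
move=> sP hf /memv_rad vR; have [->|f0] := eqVneq f 0; first by rewrite zero_lfunE.
by apply/eqP; rewrite -memv_ker; apply: vR; apply: ker_maximal.
Qed.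

Lemma quo_maximal_simple N (U : {vspace N}) (mU : maximal_submod U)
    (hU : submod U) : simple_mod (quo_mod hU).
Proof.
case: mU => _ nU mU; have hq := quo_proj_hom hU; split.
  apply: contra nU => /eqP q0; rewrite -(quo_proj_ker U) eqEsubv subvf /=.
  by apply/subvP=> v _; rewrite memv_ker -memv0 -q0; apply: memvf.
move=> W hW; pose T := (quo_proj U @^-1: W)%VS.
have WT : W = (quo_proj U @: T)%VS by rewrite lpreimK // quo_proj_img subvf.
have UT : (U <= T)%VS.
  apply/subvP=> v; rewrite -{1}(quo_proj_ker U) memv_ker -memv_preim.
  by move=> /eqP->; apply: mem0v.
have [TU|Tf] := mU T (preim_submod hq hW) UT.
  by left; rewrite WT TU; apply/eqP; rewrite -lkerE quo_proj_ker.
by right; rewrite WT Tf quo_proj_img.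
Qed.

Lemma isomorphic_sym N P : isomorphic N P -> isomorphic P N.
Proof.
case=> f [hf /eqP kf If]; exists (f^-1)%VF.
have fK := lker0_lfunK kf; have fVK v : f ((f^-1)%VF v) = v by rewrite limg_lfunVK ?If ?memvf.
split=> [m v||].
- by rewrite -{1}(fVK v) -hf fK.
- by apply/eqP/lker0P=> u v /(congr1 f); rewrite !fVK.
- apply/eqP; rewrite eqEsubv subvf; apply/subvP=> v _.
  by rewrite -(fK v) memv_img ?memvf.
Qed.

Lemma isomorphic_trans N P Q : isomorphic N P -> isomorphic P Q -> isomorphic N Q.
Proof.
case=> f [hf kf If] [g [hg kg Ig]]; exists (g \o f)%VF; split.
- exact: is_hom_comp.
- have /lker0P fI : lker f == 0%VS by apply/eqP.
  have /lker0P gI : lker g == 0%VS by apply/eqP.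
  by apply/eqP/lker0P=> u v; rewrite !comp_lfunE => /gI/fI.
- by rewrite limg_comp If.
Qed.

Lemma mult_iso X Y N : isomorphic X Y -> mult X N = mult Y N.
Proof.
move=> XY; apply: eq_count => Z; apply: asbool_equiv_eq; split.
  by move=> XZ; apply: isomorphic_trans XZ; apply: isomorphic_sym.
exact: isomorphic_trans.
Qed.

(** Dimensions are compared throughout by restricting an ambient linear map to a
    bijection between subspaces. *)
Lemma dim_bij (A B : vectType k) (U : {vspace A}) (U' : {vspace B})
    (f : 'Hom(A, B)) :
  (forall u, u \in U -> f u \in U') -> (forall u, u \in U -> f u = 0 -> u = 0) ->
  (forall w, w \in U' -> exists2 u, u \in U & f u = w) -> \dim U = \dim U'.
Proof.
move=> fU fI fS; have <- : (f @: U)%VS = U'.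
  apply/vspaceP=> w; apply/memv_imgP/idP => [[u uU ->]|/fS[u uU <-]]; first exact: fU.
  by exists u.
rewrite limg_dim_eq //; apply/eqP; rewrite -subv0; apply/subvP=> u.
by rewrite memv_cap memv_ker memv0 => /andP[uU /eqP/(fI u uU)->].
Qed.

End ModuleTheory.

(** * Ext^1 from an arbitrary free presentation *)

Lemma linfun_vsprojE (k : fieldType) (A : vectType k) (U : {vspace A}) (u : A) :
  linfun (vsproj U) u = vsproj U u.
Proof. by rewrite (lfunE (vsproj U)). Qed.

Lemma corestr_hom (k : fieldType) (M : monoidType) (N P : kmod k M)
    (U : {vspace P}) (hU : submod U) (g : 'Hom(N, P)) :
  is_hom g -> (forall v, g v \in U) ->
  @is_hom k M N (sub_mod hU) (linfun (vsproj U) \o g)%VF.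
Proof.
move=> hg gU m v; apply/val_inj.
have cE x : (linfun (vsproj U) \o g)%VF x = vsproj U (g x).
  by rewrite comp_lfunE linfun_vsprojE.
by rewrite !cE [RHS]sub_actE /= hg !vsprojK ?submod_act.
Qed.

Section Restrict.
Variables (k : fieldType) (M : monoidType) (Z : kmod k M).

Definition restrict (N : kmod k M) (U : {vspace N}) (hU : submod U) :
  'Hom('Hom(N, Z), 'Hom(sub_mod hU, Z)) :=
  precomp Z (linfun vsval : 'Hom(sub_mod hU, N)).

Lemma restrictE (N : kmod k M) (U : {vspace N}) (hU : submod U) (h : 'Hom(N, Z)) u :
  restrict hU h u = h (vsval u).
Proof. by rewrite /restrict precompE comp_lfunE linfun_vsvalE. Qed.

Lemma restrict_homs (N : kmod k M) (U : {vspace N}) (hU : submod U) :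
  (restrict hU @: homs N Z <= homs (sub_mod hU) Z)%VS.
Proof.
apply/subvP=> _ /memv_imgP[h /memv_homs hh ->]; apply/memv_homs.
by rewrite /restrict precompE; apply: is_hom_comp => //; apply: vsval_hom.
Qed.

End Restrict.

Section FreePresentations.
Variables (k : fieldType) (M : finMonoidType) (S Z : kmod k M).

Local Notation free V := (free_mod M V).

Definition ker_mod (N P : kmod k M) (p : 'Hom(N, P)) (hp : is_hom p) :=
  sub_mod (ker_submod hp).

(** One half of Schanuel's lemma. Lifting p through p' and p' through p gives
    a : free V -> free V' and a' in the other direction; 1 - a' a takes values in
    the kernel of p, so on that kernel h and h a' a differ by the restriction of
    a map on free V. Hence modulo restrictions every h comes from the kernel
    of p' through a, and the statement being symmetric gives equality. *)
Lemma ext_defect_le (V V' : vectType k)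
    (p : 'Hom(free V, S)) (p' : 'Hom(free V', S))
    (hp : is_hom p) (hp' : is_hom p') :
  limg p = fullv -> limg p' = fullv ->
  (\dim (homs (ker_mod hp) Z)
     - \dim (restrict Z (ker_submod hp) @: homs (free V) Z)
   <= \dim (homs (ker_mod hp') Z)
     - \dim (restrict Z (ker_submod hp') @: homs (free V') Z))%N.
Proof.
move=> Ip Ip'.
have [a [ha pa]] := free_mod_projective hp' Ip' hp.
have [a' [ha' pa']] := free_mod_projective hp Ip hp'.
have paE x : p' (a x) = p x by rewrite -pa comp_lfunE.
have pa'E x : p (a' x) = p' x by rewrite -pa' comp_lfunE.
set H := homs (ker_mod hp) Z; set H' := homs (ker_mod hp') Z.
set R := (restrict Z (ker_submod hp) @: _)%VS.
set R' := (restrict Z (ker_submod hp') @: _)%VS.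
pose c : 'Hom(ker_mod hp, ker_mod hp') :=
  (linfun (vsproj (lker p')) \o (a \o linfun vsval))%VF.
pose c' : 'Hom(ker_mod hp', ker_mod hp) :=
  (linfun (vsproj (lker p)) \o (a' \o linfun vsval))%VF.
have hc' : is_hom c'.
  apply: corestr_hom; first by apply: is_hom_comp => //; apply: vsval_hom.
  move=> v; rewrite comp_lfunE linfun_vsvalE memv_ker pa'E -memv_ker; exact: subvsP.
have cE x : vsval (c x) = a (vsval x).
  rewrite /c !comp_lfunE linfun_vsprojE linfun_vsvalE vsprojK // memv_ker paE -memv_ker.
  exact: subvsP.
have c'E x : vsval (c' x) = a' (vsval x).
  rewrite /c' !comp_lfunE linfun_vsprojE linfun_vsvalE vsprojK // memv_ker pa'E -memv_ker.
  exact: subvsP.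
pose A : 'Hom('Hom(ker_mod hp', Z), 'Hom(ker_mod hp, Z)) := precomp Z c.
have sRH' : (R' <= H')%VS by apply: restrict_homs.
have dC : \dim (H' :\: R') = (\dim H' - \dim R')%N.
  by rewrite -(dimv_cap_compl H' R') (capv_idPr sRH') addKn.
(* A complement of R' in H' already covers H modulo R. *)
have sH : (H <= A @: (H' :\: R') + R)%VS.
  apply/subvP=> h /memv_homs hh.
  have H'E : (H' :\: R' + R')%VS = H'.
    by rewrite -{2}(capv_idPr sRH') addv_diff_cap.
  have : (h \o c')%VF \in (H' :\: R' + R')%VS.
    by rewrite H'E; apply/memv_homs; apply: is_hom_comp.
  case/memv_addP=> u uC [_ /memv_imgP[t /memv_homs ht ->] eqh].
  pose d : 'Hom(free V, ker_mod hp) :=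
    (linfun (vsproj (lker p)) \o (\1 - (a' \o a)))%VF.
  have dK v : (\1 - (a' \o a))%VF v \in lker p.
    by rewrite memv_ker add_lfunE opp_lfunE id_lfunE comp_lfunE linearB /= pa'E paE subrr.
  have hd : is_hom d.
    apply: corestr_hom dK; apply: is_homB; first exact: is_hom_id.
    exact: is_hom_comp.
  have -> : h = A u + restrict Z (ker_submod hp) ((t \o a) + (h \o d))%VF.
    apply/lfunP=> x; rewrite add_lfunE restrictE add_lfunE !comp_lfunE precompE comp_lfunE.
    (* The decomposition of h c', evaluated at c x; note that c' c = a' a on the kernel. *)
    have eqx : h (c' (c x)) = u (c x) + t (a (vsval x)).
      by rewrite -(comp_lfunE h c') eqh (add_lfunE u) restrictE cE.
    rewrite addrA -eqx -linearD; congr (h _); apply: val_inj.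
    rewrite /= c'E cE linfun_vsprojE vsprojK ?dK //.
    by rewrite add_lfunE opp_lfunE id_lfunE comp_lfunE addrC subrK.
  apply: memv_add; first exact: memv_img.
  by apply: memv_img; apply/memv_homs/is_homD; apply: is_hom_comp.
rewrite leq_subLR -dC addnC.
apply: leq_trans (dimvS sH) _; apply: leq_trans (dimv_add_leqif _ _).1 _.
by rewrite leq_add2r -(limg_ker_dim A (H' :\: R')) leq_addl.
Qed.

(** Cocycles vanish on the image of the next differential, so they factor
    through the syzygy; coboundaries are the restrictions of maps on the free module. *)
Lemma dim_ext1_syz : dim_ext1 S Z =
  (\dim (homs (ker_mod (@counit_hom k M S)) Z)
   - \dim (restrict Z (ker_submod (@counit_hom k M S)) @: homs (free S) Z))%N.
Proof.
set cS := ker_mod _; pose c : 'Hom(free cS, cS) := counit cS.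
have cf : limg c = fullv by apply: counit_img.
have hc : is_hom c by apply: counit_hom.
pose C := precomp Z c.
have kC : lker C == 0%VS.
  apply/lker0P=> f g; rewrite /C !precompE => /lfunP fg; apply/lfunP=> v.
  have /memv_imgP[x _ ->] : v \in limg c by rewrite cf memvf.
  by have := fg x; rewrite !comp_lfunE.
have dimC (U : {vspace 'Hom(cS, Z)}) : \dim (C @: U) = \dim U.
  by apply: limg_dim_eq; rewrite (eqP kC) capv0.
rewrite /dim_ext1.
have <- : (C @: homs cS Z)%VS = ext1_cocycles S Z.
  apply/esym/vspaceP=> h; rewrite memv_cap; apply/andP/memv_imgP.
    case=> /memv_homs hh; rewrite memv_ker precompE => /eqP/lfunP hd.
    have hv x : c x = 0 -> h x = 0.
      move=> cx0; have xK : x \in lker c by rewrite memv_ker cx0.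
      have /memv_imgP[y _ y0] : vsproj (lker c) x \in limg (counit (syz cS)).
        by rewrite counit_img memvf.
      have := hd y; rewrite comp_lfunE zero_lfunE syz_diffE -y0.
      by rewrite vsprojK.
    have cK v : c (c^-1 v)%VF = v by rewrite limg_lfunVK ?cf ?memvf.
    have hcK x : h (c^-1 (c x))%VF = h x.
      by apply/eqP; rewrite -subr_eq0 -linearB /= hv // linearB /= cK subrr.
    exists (h \o c^-1)%VF.
      apply/memv_homs=> m v; rewrite !(comp_lfunE h) -{1}(cK v) -hc hcK hh //.
    by rewrite /C precompE; apply/lfunP=> x; rewrite !comp_lfunE hcK.
  case=> g /memv_homs hg ->; rewrite /C precompE; split.
    by apply/memv_homs; apply: is_hom_comp.
  rewrite memv_ker precompE; apply/eqP/lfunP=> y; rewrite !comp_lfunE zero_lfunE linfun_vsvalE.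
  have := subvsP (counit (syz cS) y); rewrite memv_ker => /eqP ->; exact: linear0.
rewrite dimC -(dimC (_ @: _)%VS) -limg_comp; congr (_ - \dim (_ @: _))%N.
by apply/lfunP=> h; rewrite comp_lfunE /C /restrict !precompE comp_lfunA.
Qed.

Lemma dim_ext1_free (V : vectType k) (p : 'Hom(free V, S)) (hp : is_hom p) :
  limg p = fullv ->
  dim_ext1 S Z = (\dim (homs (ker_mod hp) Z)
                  - \dim (restrict Z (ker_submod hp) @: homs (free V) Z))%N.
Proof.
move=> Ip; rewrite dim_ext1_syz; apply/eqP; rewrite eqn_leq.
by rewrite !ext_defect_le // counit_img.
Qed.

Lemma killing_hom_sub (N : kmod k M) (A : N -> Prop) :
  let K (h : 'Hom(N, Z)) := is_hom h /\ forall v, A v -> h v = 0 in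
  K 0 /\ forall c h h', K h -> K h' -> K (c *: h + h').
Proof.
have [h0 hL] := is_hom_sub N Z; split=> [|c h h' [hh hA] [hh' hA']].
  by split=> // v _; rewrite zero_lfunE.
split; first exact: hL.
by move=> v Av; rewrite add_lfunE scale_lfunE hA // hA' // scaler0 addr0.
Qed.

Definition killing_homs (N : kmod k M) (A : N -> Prop) : {vspace 'Hom(N, Z)} :=
  vspace_of (fun h => is_hom h /\ forall v, A v -> h v = 0).

Lemma memv_killing_homs (N : kmod k M) (A : N -> Prop) h :
  h \in killing_homs A <-> is_hom h /\ forall v, A v -> h v = 0.
Proof. by have [? ?] := killing_hom_sub A; apply: vspace_ofP. Qed.

(** B plays the kernel of a map from the free module onto some P above S with
    Ext^1(P, Z) = 0 (the second hypothesis) and Hom(P, Z) = Hom(S, Z) (the third).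
    Then Hom(ker p, Z) is the direct sum of the maps killing B and of the
    restrictions of maps on the free module. *)
Lemma dim_ext1_relative (V : vectType k) (p : 'Hom(free V, S)) (hp : is_hom p)
    (B : free V -> Prop) :
    limg p = fullv ->
    (forall h : 'Hom(ker_mod hp, Z), is_hom h ->
       exists2 h' : 'Hom(free V, Z), is_hom h' &
         forall z : ker_mod hp, B (vsval z) -> h' (vsval z) = h z) ->
    (forall h : 'Hom(free V, Z), is_hom h ->
       (forall z, B z -> p z = 0 -> h z = 0) -> forall z, p z = 0 -> h z = 0) ->
  dim_ext1 S Z = \dim (killing_homs (fun z : ker_mod hp => B (vsval z))).
Proof.
move=> Ip ext rig; rewrite (dim_ext1_free hp Ip).
set H := homs _ Z; set R := (_ @: _)%VS; set K := killing_homs _.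
have RK0 : (K :&: R = 0)%VS.
  apply/eqP; rewrite -subv0; apply/subvP=> g; rewrite memv_cap memv0.
  case/andP=> /memv_killing_homs[_ kh] /memv_imgP[h /memv_homs hh eqh].
  rewrite {g}eqh in kh *.
  apply/eqP/lfunP=> z; rewrite restrictE zero_lfunE; apply: rig => //; last first.
    by apply/eqP; rewrite -memv_ker; apply: subvsP.
  move=> y By py; have yK : y \in lker p by rewrite memv_ker py.
  have := kh (vsproj (lker p) y); rewrite restrictE vsprojK //; exact.
have KRH : (K + R = H)%VS.
  apply/eqP; rewrite eqEsubv subv_add restrict_homs andbT; apply/andP; split.
    by apply/subvP=> h /memv_killing_homs[hh _]; apply/memv_homs.
  apply/subvP=> h /memv_homs hh; have [h' hh' eqh'] := ext h hh.
  rewrite -(subrK (restrict Z (ker_submod hp) h') h) memv_add //; last first.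
    by apply: memv_img; apply/memv_homs.
  apply/memv_killing_homs; split.
    apply: is_homB => //; apply/memv_homs; apply: (subvP (restrict_homs _ _)).
    by apply: memv_img; apply/memv_homs.
  by move=> z Bz; rewrite add_lfunE opp_lfunE restrictE eqh' // subrr.
by rewrite -KRH dimv_disjoint_sum // addnK.
Qed.

End FreePresentations.

(** * Maschke's theorem and multiplicities *)

Section Maschke.
Variables (k : fieldType) (G : finGroupType).
Hypothesis G_unit : #|G|%:R != 0 :> k.
Implicit Types N X Y : kmod k G.

(** Averages over the group the linear extension v |-> h (vsproj U v). *)
Lemma maschke N X (U : {vspace N}) (hU : submod U) (h : 'Hom(sub_mod hU, X)) :
  is_hom h ->
  exists2 h' : 'Hom(N, X), is_hom h' & forall u : sub_mod hU, h' (vsval u) = h u.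
Proof.
move=> hh; pose h0 : 'Hom(N, X) := (h \o linfun (vsproj U))%VF.
have h0E v : h0 v = h (vsproj U v) by rewrite comp_lfunE linfun_vsprojE.
pose h' : 'Hom(N, X) := #|G|%:R^-1 *: \sum_(g : G) (act (g^-1)%g \o h0 \o act g)%VF.
have h'E v : h' v = #|G|%:R^-1 *: \sum_(g : G) act (g^-1)%g (h0 (act g v)).
  rewrite scale_lfunE sum_lfunE; congr (_ *: _); apply: eq_bigr => g _.
  by rewrite -comp_lfunA (comp_lfunE (act _)) (comp_lfunE h0).
exists h'.
  move=> x v; rewrite !h'E linearZ; congr (_ *: _); rewrite linear_sum.
  rewrite (reindex_inj (mulIg (x^-1)%g)); apply: eq_bigr => g _.
  by rewrite -actMv mulgKV invMg invgK actMv.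
move=> u; rewrite h'E (eq_bigr (fun=> h u)) => [|g _].
  by rewrite sumr_const -scaler_nat scalerA mulVf // scale1r.
have -> : act g (vsval u) = vsval (act g u) :> N by rewrite sub_actE.
by rewrite h0E vsvalK hh -actMv mulVg act1v.
Qed.

(** Hom( , X) is exact, since maps on a submodule extend. *)
Lemma dim_homs_exact N X (U : {vspace N}) (hU : submod U) :
  \dim (homs N X) = (\dim (homs (quo_mod hU) X) + \dim (homs (sub_mod hU) X))%N.
Proof.
rewrite -(limg_ker_dim (restrict X hU) (homs N X)); congr addn; last first.
  congr (\dim _); apply/eqP; rewrite eqEsubv restrict_homs /=.
  apply/subvP=> h /(@memv_homs k G (sub_mod hU) X) hh; have [h' hh' eqh] := maschke hh.
  have -> : h = restrict X hU h'.
    by apply/lfunP=> u; rewrite restrictE eqh.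
  by apply: memv_img; apply/memv_homs.
symmetry; pose q : 'Hom(N, quo_mod hU) := quo_proj U.
have hq : is_hom q by apply: quo_proj_hom.
have qv w : q (vsval w) = w by apply: quo_proj_val.
apply: (dim_bij (f := precomp X q)) => [h /memv_homs hh|h _|h].
- rewrite memv_cap memv_ker precompE; apply/andP; split.
    by apply/memv_homs; apply: is_hom_comp.
  apply/eqP/lfunP=> u; rewrite restrictE comp_lfunE zero_lfunE.
  have -> : q (vsval u) = 0.
    by apply/eqP; rewrite -memv_ker quo_proj_ker; apply: subvsP.
  exact: linear0.
- rewrite precompE => /lfunP h0; apply/lfunP=> w.
  by rewrite -(qv w) -(comp_lfunE h q) h0 !zero_lfunE.
rewrite memv_cap memv_ker => /andP[/memv_homs hh /eqP/lfunP h0].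
pose h' : 'Hom(quo_mod hU, X) := (h \o linfun vsval)%VF.
have h'E w : h' w = h (vsval w) by rewrite comp_lfunE linfun_vsvalE.
have h'q v : h' (q v) = h v.
  rewrite h'E; apply/esym/eqP; rewrite -subr_eq0 -linearB /=.
  have := h0 (vsproj U (v - vsval (q v))).
  by rewrite restrictE zero_lfunE vsprojK ?quo_projB // => ->.
exists h'; last by apply/lfunP=> v; rewrite precompE comp_lfunE.
by apply/memv_homs=> m w; rewrite -(qv w) -hq !h'q hh.
Qed.

(** Over a group of invertible order this implies simplicity
    (abs_simple_simple), which is easier than checking simplicity of
    Hom_k(V, W) directly. *)
Definition abs_simple X :=
  (fullv : {vspace X}) != 0%VS /\
  forall f : 'End(X), is_hom f -> exists c : k, f = c *: \1%VF.

(** A projection onto a submodule is a scalar, so it is 0 or the identity. *)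
Lemma abs_simple_simple X : abs_simple X -> simple_mod X.
Proof.
case=> X0 EX; split=> // U hU.
have [h' hh' h'K] := maschke (@is_hom_id k G (sub_mod hU)).
have [c fc] : exists c : k, (linfun vsval \o h' : 'End(X))%VF = c *: \1%VF.
  by apply: EX; apply: (is_hom_comp (P := sub_mod hU)) => //; apply: vsval_hom.
have fE x : vsval (h' x) = c *: x.
  by rewrite -linfun_vsvalE -comp_lfunE fc scale_lfunE id_lfunE.
have [->|U0] := eqVneq U 0%VS; [by left | right].
have c1 : c = 1.
  have := fE (vpick U); have -> : vpick U = vsval (vsproj U (vpick U)).
    by rewrite vsprojK ?memv_pick.
  rewrite h'K id_lfunE vsprojK ?memv_pick // -{1}[vpick U]scale1r => /eqP.
  rewrite -subr_eq0 -scalerBl scaler_eq0 vpick0 (negPf U0) orbF subr_eq0.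
  by move/eqP.
apply/eqP; rewrite eqEsubv subvf; apply/subvP=> x _.
by rewrite -[x]scale1r -c1 -fE subvsP.
Qed.

Lemma dim_homs_simple X Y : abs_simple X -> simple_mod Y ->
  \dim (homs Y X) = `[< isomorphic X Y >].
Proof.
move=> aX sY; have sX := abs_simple_simple aX; have [_ EX] := aX.
have [iso|niso] := asboolP (isomorphic X Y); last first.
  apply/eqP; rewrite dimv_eq0 -subv0; apply/subvP=> h /memv_homs hh.
  rewrite memv0; apply: contraPT niso => h0 n; apply: n.
  apply: isomorphic_sym; exists h; split=> //.
    exact/eqP/(simple_hom_inj sY hh h0).
  exact: (simple_hom_surj sX hh h0).
have [g [hg /eqP kg Ig]] := isomorphic_sym iso.
have gK := lker0_lfunK kg; have [f [hf _ If]] := iso.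
have -> : homs Y X = <[g]>%VS.
  apply/eqP; rewrite eqEsubv; apply/andP; split; last first.
    by apply/subvP=> _ /vlineP[c ->]; apply: memvZ; apply/memv_homs.
  apply/subvP=> h /memv_homs hh; apply/vlineP.
  have hgV : is_hom (g^-1)%VF.
    move=> m x; have /memv_imgP[y _ ->] : x \in limg g by rewrite Ig memvf.
    by rewrite -hg !gK.
  have [c hc] := EX _ (is_hom_comp hh hgV); exists c; apply/lfunP=> y.
  by rewrite -{1}(gK y) -(comp_lfunE h) hc !scale_lfunE id_lfunE.
rewrite dim_vline; congr nat_of_bool; apply/eqP => g0.
have [/negP[]] := sX; apply/eqP; rewrite -Ig g0; exact: lim0g.
Qed.

(** Both sides are additive along a composition series, and agree on simple
    modules by Schur's lemma. *)
Lemma dim_homs_mult X N : abs_simple X -> \dim (homs N X) = mult X N.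
Proof.
move=> aX; rewrite /mult; have := factorsP N; move: (factors N) => s.
elim=> {N s} [N N0|N U hU s sQ _ IH] /=.
  apply/eqP; rewrite dimv_eq0 -subv0; apply/subvP=> h _; rewrite memv0.
  apply/eqP/lfunP=> v; have : v \in fullv by apply: memvf.
  by rewrite N0 memv0 => /eqP->; rewrite !linear0.
by rewrite (dim_homs_exact _ hU) IH dim_homs_simple.
Qed.
End Maschke.

(** * The bimodule Hom_k(V, W) *)

Section DualBasis.
Variables (k : fieldType) (V : vectType k).

Definition basv (j : 'I_(\dim {:V})) : V := (vbasis {:V})`_j.
Definition dualb (j : 'I_(\dim {:V})) : 'Hom(V, k^o) :=
  linfun (coord (vbasis {:V}) j : V -> k^o).

Lemma dualbE j v : dualb j v = coord (vbasis {:V}) j v.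
Proof. by rewrite lfunE. Qed.

Lemma basv_sum v : v = \sum_j (dualb j v : k) *: basv j.
Proof.
rewrite {1}(coord_vbasis (memvf v)); apply: eq_bigr => j _.
by rewrite dualbE.
Qed.

Lemma dualb_sum (phi : 'Hom(V, k^o)) : phi = \sum_j (phi (basv j) : k) *: dualb j.
Proof.
apply/lfunP=> v; rewrite sum_lfunE {1}(basv_sum v) linear_sum.
apply: eq_bigr => j _; rewrite linearZ scale_lfunE.
by rewrite /GRing.scale /= mulrC.
Qed.

(** Vectors of V are tested against linear forms: this is how identities in
    L (x) V are reduced below to identities in L. *)
Lemma dualb_inj v : (forall phi : 'Hom(V, k^o), phi v = 0) -> v = 0.
Proof.
by move=> v0; rewrite (basv_sum v) big1 // => j _; rewrite v0 scale0r.
Qed.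
End DualBasis.

Section RankOne.
Variables (k : fieldType) (V W : vectType k).

Definition rank1_fun (w : W) (phi : 'Hom(V, k^o)) (v : V) : W := (phi v : k) *: w.

Lemma rank1_fun_is_linear w phi : linear (rank1_fun w phi).
Proof. by move=> c u v; rewrite /rank1_fun linearP /= scalerDl scalerA. Qed.
HB.instance Definition _ w phi :=
  GRing.isSemilinear.Build k V W *:%R (rank1_fun w phi)
    (GRing.semilinear_linear (rank1_fun_is_linear w phi)).

Definition rank1 w phi : 'Hom(V, W) := linfun (rank1_fun w phi).

Lemma rank1E w phi v : rank1 w phi v = (phi v : k) *: w.
Proof. by rewrite lfunE. Qed.

Lemma rank1_linearl phi : linear (rank1^~ phi).
Proof.
move=> c w w'; apply/lfunP=> v.
by rewrite add_lfunE scale_lfunE !rank1E scalerDr !scalerA mulrC.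
Qed.

Lemma rank1_linearr w : linear (rank1 w).
Proof.
move=> c f f'; apply/lfunP=> v.
by rewrite add_lfunE scale_lfunE !rank1E add_lfunE scale_lfunE scalerDl scalerA.
Qed.

(** The first argument of rank1 as the last one, to carry the linear structure. *)
Definition rank1l phi w := rank1 w phi.
HB.instance Definition _ phi :=
  GRing.isSemilinear.Build k W 'Hom(V, W) *:%R (rank1l phi)
    (GRing.semilinear_linear (rank1_linearl phi)).
HB.instance Definition _ w :=
  GRing.isSemilinear.Build k 'Hom(V, k^o) 'Hom(V, W) *:%R (rank1 w)
    (GRing.semilinear_linear (rank1_linearr w)).

Lemma rank1_sum (u : 'Hom(V, W)) : u = \sum_j rank1 (u (basv j)) (dualb j).
Proof.
apply/lfunP=> v; rewrite sum_lfunE {1}(basv_sum v) linear_sum.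
by apply: eq_bigr => j _; rewrite linearZ rank1E.
Qed.

Lemma tens_eq (U : vectType k) (X : vectType k) (f g : 'Hom(tens W U, X)) :
  (forall w u, f (ptens w u) = g (ptens w u)) -> f = g.
Proof.
move=> fg; apply/lfunP=> Y; rewrite (matrix_sum_delta Y) !linear_sum.
apply: eq_bigr => i _; rewrite !linear_sum; apply: eq_bigr => j _.
by rewrite !linearZ -ptens_basis /= fg.
Qed.

Definition tens_hom_fun (X : tens W 'Hom(V, k^o)) : 'Hom(V, W) :=
  \sum_i \sum_j X i j *: rank1 (vbasis {:W})`_i (vbasis {:'Hom(V, k^o)})`_j.

Lemma tens_hom_fun_is_linear : linear tens_hom_fun.
Proof.
move=> c X Y; rewrite /tens_hom_fun scaler_sumr -big_split; apply: eq_bigr => i _ /=.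
rewrite scaler_sumr -big_split; apply: eq_bigr => j _ /=.
by rewrite !mxE scalerDl scalerA.
Qed.
HB.instance Definition _ :=
  GRing.isSemilinear.Build k (tens W 'Hom(V, k^o)) 'Hom(V, W) *:%R tens_hom_fun
    (GRing.semilinear_linear tens_hom_fun_is_linear).

(** The isomorphism W (x) D(V) -> Hom(V, W) sending w (x) phi to v |-> phi(v) w. *)
Definition tens_hom : 'Hom(tens W 'Hom(V, k^o), 'Hom(V, W)) := linfun tens_hom_fun.

Lemma tens_homE w phi : tens_hom (ptens w phi) = rank1 w phi.
Proof.
rewrite lfunE /= /tens_hom_fun.
rewrite -[RHS]/(rank1l _ _) [w in RHS](coord_vbasis (memvf w)) !linear_sum /=.
apply: eq_bigr => i _; rewrite !linearZ /= /rank1l.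
rewrite [phi in RHS](coord_vbasis (memvf phi)) !linear_sum /=.
by apply: eq_bigr => j _; rewrite mxE !linearZ /= scalerA mulrC.
Qed.

Lemma tens_hom_surj : limg tens_hom = fullv.
Proof.
apply/eqP; rewrite eqEsubv subvf; apply/subvP=> u _.
rewrite (rank1_sum u); apply: memv_suml => j _.
by rewrite -tens_homE memv_img ?memvf.
Qed.

Lemma tens_hom_inj : lker tens_hom = 0%VS.
Proof.
pose g_fun (u : 'Hom(V, W)) : tens W 'Hom(V, k^o) := \sum_j ptens (u (basv j)) (dualb j).
have gl : linear g_fun.
  move=> c u v; rewrite /g_fun scaler_sumr -big_split; apply: eq_bigr => j _ /=.
  by rewrite add_lfunE scale_lfunE -[ptens (_ + _) _]/(ptensr _ _) linearP.
pose gL := GRing.isSemilinear.Build k 'Hom(V, W) (tens W 'Hom(V, k^o)) *:%R g_fun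
    (GRing.semilinear_linear gl).
pose g_lin : {linear 'Hom(V, W) -> tens W 'Hom(V, k^o)} := HB.pack g_fun gL.
have gK : (linfun g_lin \o tens_hom = \1)%VF.
  apply: tens_eq => w phi; rewrite comp_lfunE tens_homE id_lfunE lfunE /= /g_fun.
  rewrite [phi in RHS](dualb_sum phi) linear_sum; apply: eq_bigr => j _.
  by rewrite rank1E -[LHS]/(ptensr _ _) !linearZ.
apply/eqP/lker0P=> X Y eqXY.
by rewrite -[X]id_lfunE -[Y]id_lfunE -gK !comp_lfunE eqXY.
Qed.
End RankOne.

Section HomModule.
Variables (k : fieldType) (G H : finGroupType).
Variables (W : kmod k G) (V : kmod k H).

Definition biact_fun (x : G * H) (u : 'Hom(V, W)) : 'Hom(V, W) :=
  (act x.1 \o u \o act (x.2^-1)%g)%VF.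

Lemma biact_fun_is_linear x : linear (biact_fun x).
Proof.
move=> c u u'; rewrite /biact_fun.
by rewrite comp_lfunDr comp_lfunDl -comp_lfunZr -comp_lfunZl.
Qed.
HB.instance Definition _ x :=
  GRing.isSemilinear.Build k 'Hom(V, W) 'Hom(V, W) *:%R (biact_fun x)
    (GRing.semilinear_linear (biact_fun_is_linear x)).

Definition biact x : 'End('Hom(V, W)) := linfun (biact_fun x).

Lemma biactE x u v : biact x u v = act x.1 (u (act (x.2^-1)%g v)).
Proof.
by rewrite /biact (lfunE (biact_fun x)) /= /biact_fun -comp_lfunA (comp_lfunE (act _)) (comp_lfunE u).
Qed.

Fact biact1 : biact 1%g = \1%VF.
Proof. by apply/lfunP=> u; apply/lfunP=> v; rewrite biactE id_lfunE invg1 !act1v. Qed.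

Fact biactM x y : biact (x * y)%g = (biact x \o biact y)%VF.
Proof.
apply/lfunP=> u; apply/lfunP=> v.
by rewrite (comp_lfunE (biact x)) !biactE /= invMg !actMv.
Qed.

Definition hom_bimod : kmod k (G * H)%type := KMod biact1 biactM.

Lemma hom_bimodE x (u : hom_bimod) v :
  (act x u : 'Hom(V, W)) v = act x.1 ((u : 'Hom(V, W)) (act (x.2^-1)%g v)).
Proof. exact: biactE. Qed.

Lemma tensD_hom_bimod : isomorphic (tensD W V) hom_bimod.
Proof.
exists (tens_hom V W); split; [|exact: tens_hom_inj|exact: tens_hom_surj].
move=> x X.
have /lfunP/(_ X) : (tens_hom V W \o tensD_act W V x = biact x \o tens_hom V W)%VF.
  apply: tens_eq => w phi.
  rewrite (comp_lfunE (tens_hom V W)) (comp_lfunE (biact x)) tensD_actE !tens_homE.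
  by apply/lfunP=> v; rewrite biactE !rank1E (comp_lfunE phi) linearZ.
by rewrite (comp_lfunE (tens_hom V W)) (comp_lfunE (biact x)).
Qed.

(** For an endomorphism T, the map w |-> T (w phi) v commutes with G, so it is
    multiplication by a scalar c phi v. This is bilinear in phi and v, hence of
    the form phi (C v), and C commutes with H, so it is a scalar too. *)
Lemma hom_bimod_abs_simple :
    splitting_field k G -> splitting_field k H ->
    simple_mod W -> simple_mod V ->
  abs_simple hom_bimod.
Proof.
move=> sG sH sW sV.
have [i0] : exists i : 'I_(\dim {:W}), basv i != 0.
  have [w w0] := simple_neq0 sW; apply/existsP; apply: contra_neqT w0.
  rewrite negb_exists => /forallP vb0; rewrite (basv_sum w) big1 // => i _.
  by have:= vb0 i; rewrite negbK => /eqP->; rewrite scaler0.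
set w0 := basv i0 => w0_neq0; set mu := dualb i0.
(* mu reads off the scalar by which an endomorphism of W acts on w0. *)
have mu1 : mu w0 = 1.
  by rewrite dualbE coord_free ?eqxx // (basis_free (vbasisP _)).
split.
  have [v v0] := simple_neq0 sV.
  apply/eqP => hom0.
  have [j vj] : exists j, dualb j v != 0.
    apply/existsP; apply: contra_neqT v0.
    rewrite negb_exists => /forallP vb0; rewrite (basv_sum v) big1 // => i _.
    by have:= vb0 i; rewrite negbK => /eqP->; rewrite scale0r.
  have : rank1 w0 (dualb j) \in (fullv : {vspace hom_bimod}) by apply: memvf.
  rewrite hom0 memv0 => /eqP/lfunP/(_ v); rewrite rank1E zero_lfunE => /eqP.
  by rewrite scaler_eq0 (negPf vj) (negPf w0_neq0).
move=> T hT.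
pose T' (u : 'Hom(V, W)) : 'Hom(V, W) := T u.
have T'E x u v : T' (biact x u) v = act x.1 (T' u (act (x.2^-1)%g v)).
  by rewrite /T' -hom_bimodE -hT.
pose c (phi : 'Hom(V, k^o)) v : k := mu (T' (rank1 w0 phi) v).
have cE phi v w : T' (rank1 w phi) v = c phi v *: w.
  pose E_fun w := T' (rank1l phi w) v.
  have El : linear E_fun.
    by move=> a u u'; rewrite /E_fun /T' !linearP add_lfunE scale_lfunE.
  pose EL := GRing.isSemilinear.Build k W W *:%R E_fun (GRing.semilinear_linear El).
  pose E : {linear W -> W} := HB.pack E_fun EL.
  have hE : is_hom (linfun E : 'End(W)).
    move=> g u; rewrite !lfunE /= /E_fun.
    have -> : rank1l phi (act g u) = biact (g, 1%g) (rank1l phi u).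
      by apply/lfunP=> x; rewrite biactE /= invg1 act1v !rank1E linearZ.
    by rewrite T'E /= invg1 act1v.
  have [b /lfunP Eb] := sG _ sW _ hE.
  have EbE u : T' (rank1 u phi) v = b *: u.
    by have := Eb u; rewrite lfunE /= scale_lfunE id_lfunE.
  rewrite EbE; congr (_ *: _); rewrite /c EbE linearZ /= mu1.
  by rewrite /GRing.scale /= mulr1.
pose C : 'End(V) := \sum_j rank1 (basv j) (mu \o T (rank1 w0 (dualb j)) : 'Hom(V, k^o))%VF.
have CE v (phi : 'Hom(V, k^o)) : phi (C v) = c phi v.
  rewrite /C sum_lfunE linear_sum /= {2}(dualb_sum phi) /c /T' !linear_sum /=.
  rewrite sum_lfunE linear_sum; apply: eq_bigr => j _.
  rewrite rank1E (comp_lfunE mu) !linearZ /= scale_lfunE linearZ /=.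
  by rewrite /GRing.scale /= mulrC.
have hC : is_hom C.
  move=> h v; apply/eqP; rewrite -subr_eq0; apply/eqP/dualb_inj => phi.
  apply/eqP; rewrite linearB subr_eq0 /= CE -(comp_lfunE phi (act h)) CE /c; apply/eqP.
  have -> : rank1 w0 (phi \o act h)%VF = biact (1%g, h^-1)%g (rank1 w0 phi).
    by apply/lfunP=> x; rewrite biactE /= invgK act1v !rank1E comp_lfunE.
  by rewrite T'E /= invgK act1v.
have [b /lfunP Cb] := sH _ sV _ hC; exists b; apply/lfunP=> u.
rewrite scale_lfunE id_lfunE {1}[u](rank1_sum u) [u in RHS](rank1_sum u).
rewrite linear_sum scaler_sumr; apply: eq_bigr => j _.
apply/lfunP=> v; rewrite scale_lfunE -[LHS]/(T' _ _) cE rank1E -CE Cb.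
by rewrite scale_lfunE id_lfunE linearZ scalerA.
Qed.
End HomModule.

(** * Stability in finite monoids and the apex of a simple module *)

Section Green.
Variable M : finMonoidType.
Implicit Types (e f : idem M) (a b c m r x y : M).
Local Open Scope group_scope.

Lemma nonaboveP e m : reflect (exists x y, x * m * y = idval e) (m \notin nonabove e).
Proof.
rewrite inE negbK; apply: (iffP existsP) => [[x /existsP[y /eqP h]]|[x [y h]]].
  by exists x, y.
by exists x; apply/existsP; exists y; apply/eqP.
Qed.

(** Iterating e = a y b gives e = a^i e (y b)^i, and some power of y b is an
    idempotent, which therefore fixes e on the right. *)
Lemma stable_right e a b y : idval e * y = y -> a * y * b = idval e -> exists c, y * c = idval e.
Proof.
move=> ey ayb; have [n n0 iE] := idempotent_power (y * b).
have it i : a ^+ i * idval e * (y * b) ^+ i = idval e.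
  elim: i => [|i IHi]; first by rewrite !expg0 mul1g mulg1.
  have -> : a ^+ i.+1 * idval e * (y * b) ^+ i.+1
            = a ^+ i * (a * (idval e * y) * b) * (y * b) ^+ i.
    by rewrite expgSr expgS !mulgA.
  by rewrite ey ayb IHi.
have eE : idval e * (y * b) ^+ n = idval e.
  by rewrite -{1}(it n) -mulgA (eqP iE) it.
exists (b * (y * b) ^+ n.-1).
by rewrite -[RHS]eE; case: (n) n0 => // n' _; rewrite expgS !mulgA ey.
Qed.

Lemma stable_left e a b y : y * idval e = y -> a * y * b = idval e -> exists c, c * y = idval e.
Proof.
move=> ye ayb; have [n n0 iE] := idempotent_power (a * y).
have it i : (a * y) ^+ i * idval e * b ^+ i = idval e.
  elim: i => [|i IHi]; first by rewrite !expg0 mul1g mulg1.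
  have -> : (a * y) ^+ i.+1 * idval e * b ^+ i.+1
            = (a * y) ^+ i * (a * (y * idval e) * b) * b ^+ i.
    by rewrite expgSr expgS !mulgA.
  by rewrite ye ayb IHi.
have eE : (a * y) ^+ n * idval e = idval e.
  by rewrite -{1}(it n) !mulgA (eqP iE) it.
exists ((a * y) ^+ n.-1 * a).
by rewrite -[RHS]eE; case: (n) n0 => // n' _; rewrite expgSr -!mulgA ye.
Qed.

Lemma mem_Rclass e r : idval e * r = r -> r \notin nonabove e -> r \in Rclass e.
Proof.
move=> er /nonaboveP[x [y xy]]; have [c rc] := stable_right er xy.
by apply/RclassP; split=> //; exists c.
Qed.

Lemma Rclass_above e r : r \in Rclass e -> r \notin nonabove e.
Proof. by case/RclassP=> -[x ex] _; apply/nonaboveP; exists 1, x; rewrite mul1g. Qed.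

(** Stability: within e M e, being J-equivalent to e means being a unit. *)
Lemma mem_maxsub e x :
  idval e * x = x -> x * idval e = x -> x \notin nonabove e -> x \in maxsub e.
Proof.
move=> ex xe /nonaboveP[a [b axb]].
have [c xc] := stable_right ex axb; have [d dx] := stable_left xe axb.
have xc' : x * (idval e * c * idval e) = idval e by rewrite !mulgA xe xc idemE.
have dx' : idval e * d * idval e * x = idval e by rewrite -!mulgA ex dx idemE.
have cd : idval e * c * idval e = idval e * d * idval e.
  have -> : idval e * c * idval e
            = idval e * d * idval e * x * (idval e * c * idval e).
    by rewrite dx' !mulgA idemE.
  by rewrite -(mulgA _ x) xc' -mulgA idemE.
apply/maxsubP; split=> //; exists (idval e * c * idval e).
split=> //; [by rewrite !mulgA idemE | by rewrite -!mulgA idemE | by rewrite cd].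
Qed.
End Green.

Section Apex.
Variables (k : fieldType) (M : finMonoidType) (S : kmod k M).
Hypothesis simpleS : simple_mod S.

(** The vectors s with n M s = 0 form a submodule, which cannot be everything. *)
Lemma act_through (n : M) (s t : S) :
  s != 0 -> act n t != 0 -> exists y, act n (act y s) != 0.
Proof.
move=> s0 nt; apply: contrapT => no; case/negP: nt; apply/eqP.
rewrite -[t]act1v.
(* The submodule that is shown to be everything if the claim fails. *)
pose A (u : S) := forall y : M, act n (act y u) = 0.
suff : A t by apply.
apply: (simple_ind simpleS (v := s)) => //.
- by move=> y; rewrite !linear0.
- move=> c u w Au Aw y.
  have -> : act n (act y (c *: u + w)) = c *: act n (act y u) + act n (act y w).
    by rewrite !linearP.
  by rewrite Au Aw scaler0 addr0.
- by move=> m u Au y; rewrite -(actMv y m u) Au.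
move=> y; apply/eqP; apply: contraPT no => ny; apply; by exists y.
Qed.

(** Take m with nonzero action and M m M of least size: by minimality m lies in
    M m' M whenever m' acts as nonzero. With m' = m this makes m regular, and
    f is the idempotent power of an element generating the same ideal. *)
Lemma apex_exists : exists f : idem M,
  (exists s : S, act (f : M) s != 0) /\
  (forall m, m \in nonabove f -> forall s : S, act m s = 0).
Proof.
pose supp m := exists s : S, act m s != 0.
(* The principal two-sided ideal of m. *)
pose I (m : M) : {set M} := [set x | [exists a : M, exists b : M, x == (a * m * b)%g]].
pose P c := `[< exists2 m, supp m & #|I m| = c >].
have [s0 ns0] := simple_neq0 simpleS.
have exP : exists c, P c.
  by exists #|I 1%g|; apply/asboolP; exists 1%g => //; exists s0; rewrite act1v.
case: (ex_minnP exP) => c /asboolP[m [t mt] <-] minm.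
have below m' : supp m' -> exists y a b : M, m = (a * (m' * y * m) * b)%g.
  case=> s ms; have [y my] := act_through mt ms.
  exists y; have sub : I (m' * y * m)%g \subset I m.
    apply/subsetP=> x; rewrite !inE => /existsP[a /existsP[b /eqP->]].
    apply/existsP; exists (a * (m' * y))%g; apply/existsP; exists b.
    by rewrite !mulgA.
  have : I (m' * y * m)%g = I m.
    apply/eqP; rewrite eqEcard sub minm //; apply/asboolP; exists (m' * y * m)%g => //.
    by exists t; rewrite !actMv.
  move/setP/(_ m); rewrite !inE.
  have -> : [exists a : M, exists b : M, m == (a * m * b)%g].
    by apply/existsP; exists 1%g; apply/existsP; exists 1%g; rewrite mulg1 mul1g.
  by case/existsP=> a /existsP[b /eqP eqm]; exists a, b.
have [y [a [b eqm]]] : exists y a b : M, m = (a * (m * y * m) * b)%g by apply: below; exists t.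
have [n n0 iE] := idempotent_power (a * m * y)%g.
have it i : m = ((a * m * y) ^+ i * m * b ^+ i)%g.
  elim: i => [|i IHi]; first by rewrite !expg0 mul1g mulg1.
  rewrite [LHS]IHi.
  have -> : ((a * m * y) ^+ i.+1 * m * b ^+ i.+1
             = (a * m * y) ^+ i * (a * (m * y * m) * b) * b ^+ i)%g.
    by rewrite expgSr expgS !mulgA.
  by rewrite -eqm.
exists (Idem iE); split.
  exists (act (m * b ^+ n)%g t); by rewrite -actMv /= mulgA -(it n).
move=> m' mn s; apply/eqP; apply: contraTT mn => ms.
have [|z [a' [b' eqm']]] := below m'; first by exists s.
apply/nonaboveP => /=; exists (a * a')%g, (z * m * b' * (y * (a * m * y) ^+ n.-1))%g.
transitivity (a * (a' * (m' * z * m) * b') * y * (a * m * y) ^+ n.-1)%g.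
  by rewrite !mulgA.
by rewrite -eqm' -expgS prednK.
Qed.
End Apex.

(** * Coinduced modules through their values *)

Section CoindEval.
Variables (k : fieldType) (M : finMonoidType) (e : idem M).
Variable V : kmod k (maxgrp e).

Local Notation pR := (pbas k (Rclass e)).

Definition coev_fun (r : M) (s : Coind V) : V :=
  (vsval s : 'Hom(Rclass_mod k e, V)) (pR r).

Lemma coev_fun_is_linear r : linear (coev_fun r).
Proof.
by move=> c s t; rewrite /coev_fun linearP add_lfunE scale_lfunE.
Qed.
HB.instance Definition _ r :=
  GRing.isSemilinear.Build k (Coind V) V *:%R (coev_fun r)
    (GRing.semilinear_linear (coev_fun_is_linear r)).

(** The value of s : Coind V at r, made total in r with value 0 off R_e. *)
Definition coev (r : M) : 'Hom(Coind V, V) := linfun (coev_fun r).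

Lemma coevE r (s : Coind V) :
  coev r s = (vsval s : 'Hom(Rclass_mod k e, V)) (pR r).
Proof. by rewrite /coev (lfunE (coev_fun r)). Qed.

Lemma coev_notin r s : r \notin Rclass e -> coev r s = 0.
Proof. by move=> rR; rewrite coevE pbas_notin // linear0. Qed.

(** When r m leaves R_e both sides vanish, so no case distinction is needed. *)
Lemma coev_act m r s : r \in Rclass e -> coev r (act m s) = coev (r * m)%g s.
Proof.
move=> rR; rewrite !coevE sub_actE /= precompE comp_lfunE.
by rewrite (pbas_in _ rR) lext_bas.
Qed.

Lemma coev_grp (g : maxgrp e) r s :
  r \in Rclass e -> coev (val g * r)%g s = act g (coev r s).
Proof.
move=> rR; rewrite !coevE.
have /memv_homs hs := subvsP s.
by rewrite -hs (pbas_in _ rR) /= lext_bas.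
Qed.

Lemma coev_inj s : (forall r, r \in Rclass e -> coev r s = 0) -> s = 0.
Proof.
move=> s0; apply/val_inj => /=; apply: lext_eq => x.
by rewrite zero_lfunE -(s0 _ (valP x)) coevE pbas_val.
Qed.

Lemma coev_ext s t : (forall r, r \in Rclass e -> coev r s = coev r t) -> s = t.
Proof.
move=> st; apply/eqP; rewrite -subr_eq0; apply/eqP/coev_inj => r rR.
by rewrite linearB /= st // subrr.
Qed.

(** The universal property of coinduction on the level of vector spaces. *)
Lemma coind_lift (U : vectType k) (F : M -> 'Hom(U, V)) :
    (forall (g : maxgrp e) r u, r \in Rclass e ->
       F (val g * r)%g u = act g (F r u)) ->
  exists i : 'Hom(U, Coind V), forall u r, r \in Rclass e -> coev r (i u) = F r u.
Proof.
move=> FG.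
pose h u : 'Hom(Rclass_mod k e, V) := lext (fun r : {x | x \in Rclass e} => F (val r) u).
have hin u : h u \in homs (Rclass_mod k e) V.
  apply/memv_homs=> g x.
  suff /lfunP/(_ x) : (h u \o Rclass_act k g = act g \o h u)%VF.
    by rewrite (comp_lfunE (h u)) (comp_lfunE (act g)).
  apply: lext_eq => r; rewrite (comp_lfunE (h u)) (comp_lfunE (act g)) !lext_bas.
  by rewrite (pbas_in _ (Rclass_lmul g (valP r))) lext_bas /= FG //; apply: (valP r).
pose i_fun u : Coind V := vsproj (homs (Rclass_mod k e) V) (h u).
have il : linear i_fun.
  move=> c u u'; rewrite /i_fun -linearP; congr (vsproj _ _).
  by apply: lext_eq => r; rewrite add_lfunE scale_lfunE !lext_bas linearP.
pose iL := GRing.isSemilinear.Build k U (Coind V) *:%R i_fun (GRing.semilinear_linear il).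
pose i : {linear U -> Coind V} := HB.pack i_fun iL.
exists (linfun i) => u r rR; rewrite coevE (lfunE i) /= /i_fun vsprojK ?hin //.
by rewrite (pbas_in _ rR) lext_bas.
Qed.
End CoindEval.
Arguments coev {k M e V} r.

(** * The tensor product of L and V as a quotient of a free module *)

Section Presentation.
Variables (k : fieldType) (M : finMonoidType) (e : idem M).
Hypothesis HF : right_fountain M.
Variable V : kmod k (maxgrp e).
Hypothesis G_unit : #|{: maxgrp e}|%:R != 0 :> k.

Local Notation G := (maxgrp e).
Local Notation L := (Ltilde_mod k e).
Local Notation Lt := (Ltilde (idval e)).
Local Notation pL := (pbas k Lt).
Local Notation F := (free_mod M V).
Local Notation dualV := 'Hom(V, k^o).
Local Notation avg := (#|{: G}|%:R^-1 : k).
Implicit Types (z : F) (lam : dualV) (g h : G) (m r : M).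

Lemma mem_Ltilde_e : idval e \in Lt.
Proof. by rewrite inE; apply/ltildeP. Qed.

Lemma mem_Ltilde_grp g : val g \in Lt.
Proof. by have := Ltilde_rmul HF g mem_Ltilde_e; rewrite (val_maxgrp_id g).1. Qed.

Lemma mulVval g : (val g^-1 * val g)%g = idval e.
Proof. by rewrite -val_maxgrpM mulVg. Qed.

Lemma mulvalV g : (val g * val g^-1)%g = idval e.
Proof. by rewrite -val_maxgrpM mulgV. Qed.

Lemma pbas_at y (l : {x | x \in Lt}) : pL y l = (y == val l)%:R.
Proof.
have [yL|yL] := boolP (y \in Lt); first by rewrite (pbas_in _ yL) ffunE eq_sym.
rewrite pbas_notin // ffunE; case: eqP => // yl.
by rewrite yl (valP l) in yL.
Qed.

(** Averaging over G makes lam(g v) m g^-1 balanced; pairing with lam turns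
    elements of L (x) V into elements of L. *)
Definition Lcoord_on_gens lam : 'Hom(V, L) :=
  avg *: \sum_(g : G) rank1 (pL (val g^-1%g) : L) (lam \o act g)%VF.

(** The coordinate along lam of the class of an element of kM (x) V in the
    G-invariants of L (x) V, a copy of the tensor product over kG. *)
Definition Lcoord lam : 'Hom(F, L) := free_lift (Lcoord_on_gens lam).

Lemma Lcoord_hom lam : is_hom (Lcoord lam).
Proof. exact: free_lift_hom. Qed.

Lemma Lcoord_gen lam m v : Lcoord lam (fgen m v) =
  avg *: \sum_(g : G) (lam (act g v) : k) *: pL (m * val g^-1)%g.
Proof.
rewrite /Lcoord free_liftE /Lcoord_on_gens scale_lfunE linearZ sum_lfunE linear_sum.
congr (_ *: _); apply: eq_bigr => g _; rewrite rank1E linearZ comp_lfunE.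
by congr (_ *: _); rewrite /= Ltilde_act_pbas // mem_Ltilde_grp.
Qed.

Lemma Lcoord_gen_at lam m v (l : {x | x \in Lt}) :
  (Lcoord lam (fgen m v) : freevect k _) l =
  avg * (lam (\sum_(g : G | (m * val g^-1)%g == val l) act g v) : k).
Proof.
rewrite Lcoord_gen ffunE sum_ffunE [LHS]/GRing.scale /=; congr (_ * _).
rewrite linear_sum [RHS]big_mkcond.
apply: eq_bigr => g _; rewrite ffunE pbas_at.
by case: eqP => _; rewrite /GRing.scale /= ?mulr1 ?mulr0.
Qed.

Lemma Lcoord_sum (I : finType) (c : I -> k) (lams : I -> dualV) z :
  Lcoord (\sum_i c i *: lams i) z = \sum_i c i *: Lcoord (lams i) z.
Proof.
suff -> : Lcoord (\sum_i c i *: lams i) = \sum_i c i *: Lcoord (lams i).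
  by rewrite sum_lfunE; apply: eq_bigr => i _; rewrite scale_lfunE.
apply: fhom_eq => m v; rewrite sum_lfunE Lcoord_gen.
under [RHS]eq_bigr => i _ do rewrite scale_lfunE Lcoord_gen scalerA mulrC -scalerA.
rewrite -scaler_sumr; congr (_ *: _).
under [RHS]eq_bigr => i _ do rewrite scaler_sumr.
rewrite exchange_big; apply: eq_bigr => g _ /=.
rewrite sum_lfunE scaler_suml; apply: eq_bigr => i _.
by rewrite scale_lfunE scalerA.
Qed.

Lemma ract_comm m g (x : L) :
  Ltilde_ract k e (val g) (act m x) = act m (Ltilde_ract k e (val g) x : L).
Proof. exact: (Ltilde_ract_hom HF). Qed.

(** The averaged tensors are G-invariant. *)
Lemma Lcoord_ract lam h z : Ltilde_ract k e (val h) (Lcoord lam z) = Lcoord (lam \o act h)%VF z.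
Proof.
rewrite -(comp_lfunE (Ltilde_ract k e (val h)) (Lcoord lam)); congr (fun_of_lfun _ z).
apply: fhom_eq => m v; rewrite (comp_lfunE (Ltilde_ract k e (val h))) !Lcoord_gen.
rewrite linearZ linear_sum; congr (_ *: _).
rewrite (reindex_inj (mulgI h)); apply: eq_bigr => g _.
rewrite linearZ (comp_lfunE lam) actMv; congr (_ *: _).
rewrite invMg val_maxgrpM mulgA.
have [mL|mL] := boolP ((m * val g^-1 * val h^-1)%g \in Lt).
  by rewrite /= Ltilde_ract_pbas // -2!mulgA mulVval (val_maxgrp_id _).2.
rewrite !pbas_notin ?linear0 //; apply: contra mL => mL.
exact: (Ltilde_rmul HF).
Qed.

(** x |-> x (x) v, as a linear map from L into kM (x) V. *)
Definition pure v : 'Hom(L, F) := lext (fun l => fgen (val l) v : F).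

Lemma pure_linear (x : L) : linear (pure^~ x).
Proof.
move=> c v w; rewrite /pure !lfunE /= /lext_fun scaler_sumr -big_split.
by apply: eq_bigr => l _; rewrite linearP /= scalerDr !scalerA mulrC.
Qed.

Lemma Lcoord_pure lam v (x : L) : Lcoord lam (pure v x) =
  avg *: \sum_(g : G) (lam (act g v) : k) *: Ltilde_ract k e (val g^-1%g) x.
Proof.
suff /lfunP/(_ x) : (Lcoord lam \o pure v)%VF =
  avg *: \sum_(g : G) (lam (act g v) : k) *: Ltilde_ract k e (val g^-1%g).
  rewrite comp_lfunE => ->; rewrite scale_lfunE sum_lfunE.
  by congr (_ *: _); apply: eq_bigr => g _; rewrite scale_lfunE.
apply: lext_eq => l; rewrite comp_lfunE lext_bas Lcoord_gen scale_lfunE sum_lfunE.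
congr (_ *: _); apply: eq_bigr => g _; rewrite scale_lfunE; congr (_ *: _).
by rewrite lext_bas.
Qed.

(** Membership in the kernel of kM (x) V -> L (x)_{kG} V. *)
Definition Lnull z := forall lam, Lcoord lam z = 0.
Local Notation B := Lnull.

Lemma Lcoord_pure_act lam v m (x : L) : Lcoord lam (pure v (act m x)) = Lcoord lam (act m (pure v x)).
Proof.
rewrite Lcoord_hom !Lcoord_pure [RHS]linearZ; congr (_ *: _); rewrite [RHS]linear_sum.
apply: eq_bigr => g _.
by rewrite linearZ ract_comm.
Qed.

Lemma Lcoord_pure_ract lam v h (x : L) :
  Lcoord lam (pure v (Ltilde_ract k e (val h) x)) = Lcoord lam (pure (act h v) x).
Proof.
rewrite !Lcoord_pure; congr (_ *: _).
rewrite (reindex_inj (mulIg h)); apply: eq_bigr => g _.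
rewrite actMv; congr (_ *: _); rewrite -comp_lfunE -Ltilde_ractM //.
by rewrite invMg mulgA mulgV mul1g.
Qed.

(** Rebuilds an element from its coordinates along a basis of V; modulo Lnull
    nothing is lost (Lcoord_from_coords). *)
Definition from_coords z : F := \sum_j pure (basv j) (Lcoord (dualb j) z).

Lemma Lcoord_from_coords lam z : Lcoord lam (from_coords z) = Lcoord lam z.
Proof.
rewrite /from_coords linear_sum /=.
under eq_bigr => j _ do rewrite Lcoord_pure.
rewrite -scaler_sumr exchange_big /= (eq_bigr (fun=> Lcoord lam z)) => [|g _].
  by rewrite sumr_const -scaler_nat scalerA mulVf // scale1r.
under eq_bigr => j _ do rewrite Lcoord_ract.
rewrite -Lcoord_sum; congr (Lcoord _ z); apply/lfunP=> v.
have {2}-> : v = act g (act (g^-1)%g v) by rewrite -actMv mulgV act1v.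
rewrite sum_lfunE [act (g^-1)%g v in RHS]basv_sum !linear_sum.
apply: eq_bigr => j _; rewrite scale_lfunE (comp_lfunE (dualb j)) !linearZ /=.
by rewrite /GRing.scale /= mulrC.
Qed.

Lemma Lnull_sub z z' : (forall lam, Lcoord lam z = Lcoord lam z') -> B (z - z').
Proof. by move=> eqz lam; rewrite linearB /= eqz subrr. Qed.

Lemma Lnull_act m z : B z -> B (act m z).
Proof. by move=> Bz lam; rewrite Lcoord_hom Bz linear0. Qed.

Lemma Lnull_gen m v : (m * idval e)%g = m -> m \notin Lt -> B (fgen m v).
Proof.
move=> me mL lam; rewrite Lcoord_gen big1 ?scaler0 // => g _.
rewrite pbas_notin ?scaler0 //; apply: contra mL => mL.
by have := Ltilde_rmul HF g mL; rewrite -mulgA mulVval me.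
Qed.

Lemma Lcoord_balance lam m h v : Lcoord lam (fgen (m * val h)%g v) = Lcoord lam (fgen m (act h v)).
Proof.
rewrite !Lcoord_gen; congr (_ *: _).
rewrite (reindex_inj (mulIg h)); apply: eq_bigr => g _.
rewrite actMv; congr (_ *: _); congr pL; rewrite invMg val_maxgrpM.
by rewrite -mulgA (mulgA (val h)) mulvalV (val_maxgrp_id _).1.
Qed.

(** The projector of kM (x) V onto its G-invariants. *)
Definition average : 'Hom(F, F) :=
  free_lift (avg *: \sum_(g : G) (linfun (fgen (val g^-1%g)) \o act g)%VF : 'Hom(V, F)).

Lemma average_hom : is_hom average.
Proof. exact: free_lift_hom. Qed.

Lemma average_gen m v : average (fgen m v) =
  avg *: \sum_(g : G) fgen (m * val g^-1)%g (act g v).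
Proof.
rewrite /average free_liftE scale_lfunE linearZ sum_lfunE linear_sum.
congr (_ *: _); apply: eq_bigr => g _.
by rewrite (comp_lfunE _ (act g)) lfunE /= act_fgen.
Qed.

Lemma average_gen_at m v y : (average (fgen m v) : {ffun M -> V}) y =
  avg *: \sum_(g : G | (m * val g^-1)%g == y) act g v.
Proof.
rewrite average_gen ffunE sum_ffunE [in RHS]big_mkcond; congr (_ *: _).
by apply: eq_bigr => g _; rewrite ffunE eq_sym.
Qed.

(** The coordinates see exactly the part of average z supported on Ltilde_e. *)
Lemma average_at lam z (l : {x | x \in Lt}) :
  lam ((average z : {ffun M -> V}) (val l)) = (Lcoord lam z : freevect k _) l.
Proof.
rewrite {1}(fgen_sum z) [in RHS](fgen_sum z) !linear_sum !sum_ffunE linear_sum.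
by apply: eq_bigr => m _; rewrite average_gen_at Lcoord_gen_at linearZ.
Qed.

Lemma average_at_out z y : (y * idval e)%g != y -> (average z : {ffun M -> V}) y = 0.
Proof.
move=> ye; rewrite (fgen_sum z) linear_sum sum_ffunE big1 // => m _.
rewrite average_gen_at big_pred0 ?scaler0 // => g; apply: contraNF ye => /eqP <-.
by rewrite -mulgA (val_maxgrp_id _).2.
Qed.

(** The average of z lives on Me, and its part on Ltilde_e is read off from the
    coordinates of z: what remains is the generators killed in L. *)
Lemma average_Lnull z : B z -> average z =
  \sum_(y : M | ((y * idval e)%g == y) && (y \notin Lt)) fgen y ((average z : {ffun M -> V}) y).
Proof.
move=> Bz; rewrite {1}(fgen_sum (average z)) [RHS]big_mkcond.
apply: eq_bigr => y _; case: ifP => // /negbT; rewrite negb_and negbK => yL.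
suff -> : (average z : {ffun M -> V}) y = 0 by apply: linear0.
case/orP: yL => [/average_at_out//|yL].
apply: dualb_inj => lam; have := average_at lam z (Sub y yL); rewrite /= => ->.
by rewrite Bz ffunE.
Qed.
End Presentation.

(** * The natural map onto Coind V and its rigidity *)

Section CoverOfCoind.
Variables (k : fieldType) (M : finMonoidType) (e : idem M).
Hypothesis HF : right_fountain M.
Variable V : kmod k (maxgrp e).
Hypothesis G_unit : #|{: maxgrp e}|%:R != 0 :> k.

Local Notation G := (maxgrp e).
Local Notation L := (Ltilde_mod k e).
Local Notation Lt := (Ltilde (idval e)).
Local Notation Re := (Rclass (idval e)).
Local Notation F := (free_mod M V).
Local Notation dualV := 'Hom(V, k^o).
Local Notation B := (@Lnull k M e V).
Implicit Types (z : F) (lam : dualV) (g h : G) (m r : M).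

(** The action of r e when r e is in G_e and 0 otherwise, in a form that is
    visibly linear and matches the averages above. *)
Definition grp_part r : 'End(V) := \sum_(g : G | (r * val g^-1)%g == idval e) act g.

Lemma grp_partE r v : grp_part r v = \sum_(g : G | (r * val g^-1)%g == idval e) act g v.
Proof. by rewrite sum_lfunE. Qed.

Lemma grp_part_mul g r v : r \in Re -> grp_part (val g * r)%g v = act g (grp_part r v).
Proof.
move=> rR; rewrite !grp_partE linear_sum (reindex_inj (mulgI g)).
apply: eq_big => [h|h _]; last by rewrite actMv.
rewrite invMg val_maxgrpM !mulgA; apply/eqP/eqP => [eq1|rh].
  have := congr1 (fun x : M => (val g^-1 * x * val g)%g) eq1.
  rewrite (_ : _ * _ = val g^-1 * val g * r * (val h^-1 * (val g^-1 * val g)))%g.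
    by rewrite !mulVval (Rclass_idl rR) !(val_maxgrp_id _).2 mulVval.
  by rewrite !mulgA.
by rewrite -(mulgA (val g)) rh (val_maxgrp_id _).2 mulvalV.
Qed.

Lemma grp_part_val g v : grp_part (val g) v = act g v.
Proof.
rewrite grp_partE (big_pred1 g) // => h /=; apply/eqP/eqP => [gh|->]; last exact: mulvalV.
apply/val_inj; have := congr1 (fun x : M => (x * val h)%g) gh.
by rewrite /= -mulgA mulVval (val_maxgrp_id _).1 (val_maxgrp_id _).2.
Qed.

Lemma grp_part_e v : grp_part (idval e) v = v.
Proof. by have := grp_part_val 1%g v; rewrite act1v. Qed.

Lemma grp_part_out r v : (r * idval e)%g \notin maxsub (idval e) -> grp_part r v = 0.
Proof.
move=> rG; rewrite grp_partE big_pred0 // => g; apply: contraNF rG => /eqP rg.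
have := congr1 (fun x : M => (x * val g)%g) rg.
rewrite /= -mulgA mulVval (val_maxgrp_id _).1 => ->; exact: valP.
Qed.

Lemma grp_part_notin r v : (idval e * r)%g = r -> r \notin Re -> grp_part r v = 0.
Proof.
move=> er rR; rewrite grp_partE big_pred0 // => g; apply: contraNF rR => /eqP rg.
by apply/RclassP; split=> //; exists (val g^-1)%g.
Qed.

(** The unit V -> Coind V : v is the value of its image at e. *)
Lemma coind_unit_ex : exists i : 'Hom(V, Coind V),
  forall v r, r \in Re -> coev r (i v) = grp_part r v.
Proof. by apply: coind_lift => g r v rR; apply: grp_part_mul. Qed.

Definition coind_unit : 'Hom(V, Coind V) := sval (cid coind_unit_ex).

Lemma coind_unitE v r : r \in Re -> coev r (coind_unit v) = grp_part r v.
Proof. by rewrite /coind_unit; case: cid => i /= iE; apply: iE. Qed.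

Definition cover : 'Hom(F, Coind V) := free_lift coind_unit.

Lemma cover_hom : is_hom cover.
Proof. exact: free_lift_hom. Qed.

Lemma cover_gen r m v : r \in Re -> coev r (cover (fgen m v)) = grp_part (r * m)%g v.
Proof.
move=> rR; rewrite /cover free_liftE coev_act //.
have [rmR|rmR] := boolP ((r * m)%g \in Re); first exact: coind_unitE.
by rewrite coev_notin // grp_part_notin // mulgA (Rclass_idl rR).
Qed.

Let le : {x | x \in Lt} := Sub (idval e) (mem_Ltilde_e e).

(** The value of cover z at r is the coefficient of e in r z, up to the order
    of G. In particular cover factors through L (x)_{kG} V. *)
Lemma cover_Lcoord lam z r : r \in Re ->
  lam (coev r (cover z)) = #|{: G}|%:R * (Lcoord lam (act r z) : freevect k _) le.
Proof.
move=> rR; rewrite (fgen_sum z) !linear_sum sum_ffunE mulr_sumr.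
apply: eq_bigr => m _ /=; rewrite cover_gen // act_fgen (Lcoord_gen_at HF).
by rewrite mulrA mulfV // mul1r grp_partE.
Qed.

Lemma cover_Lnull z : B z -> cover z = 0.
Proof.
move=> Bz; apply: coev_inj => r rR; apply: dualb_inj => lam.
by rewrite cover_Lcoord // (Lnull_act r Bz) ffunE mulr0.
Qed.

Lemma cover_surj : simple_mod V -> simple_mod (Coind V) -> limg cover = fullv.
Proof.
move=> sV sC; apply: simple_hom_surj => //; first exact: cover_hom.
have [v v0] := simple_neq0 sV; apply: contra_neq v0 => c0.
have eR : idval e \in Re by rewrite inE.
by rewrite -[v]grp_part_e -[idval e in LHS]mulg1 -cover_gen // c0 zero_lfunE linear0.
Qed.

(** x |-> cover (x (x) v) is a homomorphism from L to a simple module. *)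
Lemma cover_pure v (x : L) : simple_mod (Coind V) -> x \in rad L -> cover (pure v x) = 0.
Proof.
move=> sC xR; have hc : @is_hom k M L (Coind V) (cover \o pure v)%VF.
  move=> m y; rewrite !(comp_lfunE cover) -cover_hom.
  apply/eqP; rewrite -subr_eq0 -linearB; apply/eqP/cover_Lnull/Lnull_sub => lam.
  exact: Lcoord_pure_act.
by have := rad_hom0 sC hc xR; rewrite comp_lfunE.
Qed.

Section Rigidity.
Variables (S : kmod k M) (q : 'Hom(F, S)).
Hypotheses (simpleS : simple_mod S) (hq : is_hom q) (qB : forall z, B z -> q z = 0).

Let psi v : S := q (fgen 1%g v).

Lemma rigid_gen m v : q (fgen m v) = act m (psi v).
Proof. by rewrite /psi -hq act_fgen mulg1. Qed.

Lemma rigid_grp g v : act (val g) (psi v) = psi (act g v).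
Proof.
rewrite -rigid_gen; apply/eqP; rewrite -subr_eq0 -linearB; apply/eqP/qB/Lnull_sub => lam.
by rewrite -[val g]mul1g (Lcoord_balance HF).
Qed.

Lemma rigid_e v : act (idval e) (psi v) = psi v.
Proof. by have := rigid_grp 1%g v; rewrite act1v. Qed.

Lemma rigid_out m v : (m * idval e)%g = m -> m \notin Lt -> act m (psi v) = 0.
Proof. by move=> me mL; rewrite -rigid_gen; apply/qB/Lnull_gen. Qed.

(** Let f be the apex of S and pick y = f x e with y psi v nonzero. Then y is in
    Ltilde_e, and f = y c for some c by stability. The idempotent c y fixes y on
    the right, hence fixes e, so that e = e c f y lies in M f M. *)
Lemma rigid_apex v m (s : S) : psi v != 0 -> m \in nonabove e -> act m s = 0.
Proof.
move=> v0 mI; have [f [[t ft] fI]] := apex_exists simpleS.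
have [x fx] := act_through simpleS v0 ft.
have yE : act ((f : M) * x * idval e)%g (psi v) = act (f : M) (act x (psi v)).
  by rewrite !actMv rigid_e.
set y := ((f : M) * x * idval e)%g in yE *.
have ye : (y * idval e)%g = y by rewrite -mulgA idemE.
have fy : ((f : M) * y)%g = y by rewrite !mulgA idemE.
have yL : y \in Lt.
  by apply: contraNT fx => yL; rewrite -yE rigid_out.
have yI : y \notin nonabove f.
  by apply: contraNN fx => yI; rewrite -yE fI.
have /nonaboveP[a [b ayb]] := yI; have [c yc] := stable_right fy ayb.
have icy : idempotent (c * y)%g.
  by apply/eqP; rewrite -mulgA (mulgA y) yc fy.
have ecy : (idval e * (c * y))%g = idval e.
  move: yL; rewrite inE => /ltildeP/(_ _ icy)[h _]; apply: h.
  by rewrite mulgA yc fy.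
apply: fI; apply: contraTT mI => /nonaboveP[a' [b' amb]].
apply/nonaboveP; exists (idval e * c * a')%g, (b' * y)%g.
by rewrite -!mulgA (mulgA m) (mulgA a') (mulgA a') amb fy.
Qed.

(** Elements of e M e outside G_e act as 0, so r sees z only through the
    group part of r m for each generator m (x) v, and this is what cover records. *)
Lemma rigid_cover v0 r z : psi v0 != 0 -> r \in Re ->
  act r (q z) = psi (coev r (cover z)).
Proof.
move=> nz rR; rewrite /psi (fgen_sum z) !linear_sum; apply: eq_bigr => m _ /=.
rewrite cover_gen // rigid_gen -actMv -rigid_e -actMv.
have erm : (idval e * (r * m * idval e) = r * m * idval e)%g.
  by rewrite !mulgA (Rclass_idl rR).
have rme : (r * m * idval e * idval e = r * m * idval e)%g by rewrite -mulgA idemE.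
have [rmG|rmG] := boolP ((r * m * idval e)%g \in maxsub e).
  pose g : G := Sub (r * m * idval e)%g rmG; have gE : val g = (r * m * idval e)%g by [].
  rewrite -gE rigid_grp -/(psi _); congr psi.
  rewrite -grp_part_val gE; rewrite !grp_partE; apply: eq_bigl => h.
  by rewrite -mulgA (val_maxgrp_id _).1.
rewrite grp_part_out // /psi !linear0; apply: (rigid_apex _ nz).
apply: contraNT rmG => rmI; exact: mem_maxsub.
Qed.

(** The vectors killed by R_e form a proper submodule, hence are 0; and by
    rigid_cover the image of z is such a vector as soon as cover z = 0. *)
Lemma rigidity z : cover z = 0 -> q z = 0.
Proof.
move=> cz; apply/eqP; apply: contraT => qz.
have [v v0] : exists v, psi v != 0.
  apply: contrapT => no; case/negP: qz; apply/eqP; rewrite (fgen_sum z) linear_sum.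
  rewrite big1 // => m _ /=; rewrite rigid_gen (_ : psi _ = 0) ?linear0 //.
  by apply/eqP; apply: contraPT no => nz; apply; exists (z m).
(* Stable under any m: either r m is in R_e, or it is in I(e) and acts as 0. *)
pose A (s : S) := forall r, r \in Re -> act r s = 0.
have Aq : A (q z) by move=> r rR; rewrite (rigid_cover _ v0) // cz linear0 /psi !linear0.
have eR : idval e \in Re by rewrite inE.
suff /(_ _ eR) : A (psi v) by rewrite rigid_e => /eqP; rewrite (negPf v0).
apply: (simple_ind simpleS (v := q z)) => //.
- by move=> r _; rewrite linear0.
- by move=> c u w Au Aw r rR; rewrite linearP /= Au ?Aw // scaler0 addr0.
move=> m u Au r rR; rewrite -actMv.
have [rmR|rmR] := boolP ((r * m)%g \in Re); first exact: Au.
apply: (rigid_apex _ v0); apply: contraNT rmR => rmI; apply: mem_Rclass => //.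
by rewrite mulgA (Rclass_idl rR).
Qed.
End Rigidity.

(** Rigidity for L -> L / U, for every maximal submodule U. *)
Lemma Lcoord_rad lam z : cover z = 0 -> Lcoord lam z \in rad L.
Proof.
move=> cz; apply/memv_rad => U mU; have [hU _ _] := mU.
have hq := quo_proj_hom hU; have hx := @Lcoord_hom k M e V lam.
have rig := @rigidity (quo_mod hU) (quo_proj U \o Lcoord lam)%VF
  (quo_maximal_simple mU hU) (is_hom_comp hq hx).
rewrite (_ : (_ \in U) = (quo_proj U (Lcoord lam z) == 0)); last first.
  by rewrite -memv_ker quo_proj_ker.
apply/eqP; have := rig _ z cz; rewrite (comp_lfunE (quo_proj U)); apply.
by move=> y By; rewrite (comp_lfunE (quo_proj U)) By linear0.
Qed.
End CoverOfCoind.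

(** * Extending homomorphisms from the kernel of the cover *)

Section Relative.
Variables (k : fieldType) (M : finMonoidType) (e f : idem M).
Hypothesis HF : right_fountain M.
Variables (V : kmod k (maxgrp e)) (W : kmod k (maxgrp f)).
Hypothesis G_unit : #|{: maxgrp e}|%:R != 0 :> k.

Local Notation G := (maxgrp e).
Local Notation L := (Ltilde_mod k e).
Local Notation Lt := (Ltilde (idval e)).
Local Notation Rf := (Rclass (idval f)).
Local Notation F := (free_mod M V).
Local Notation B := (@Lnull k M e V).
Local Notation p := (cover V).
Local Notation N := (ker_mod (@cover_hom k M e V)).
Implicit Types (z : F) (g : G) (m r : M).

Lemma Ltilde_cancel m n : (n * idval e)%g = n -> (m * n)%g \in Lt -> n \in Lt.
Proof.
move=> ne mnL; rewrite -ne; apply: (@Ltilde_lcancel _ e m n).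
  exact: mem_Ltilde_e.
by rewrite -mulgA ne.
Qed.

Lemma Lcoord_average (lam : 'Hom(V, k^o)) z : Lcoord lam (average V z) = Lcoord lam z.
Proof.
rewrite -(comp_lfunE (Lcoord lam)); congr (fun_of_lfun _ z); apply: fhom_eq => m v.
rewrite (comp_lfunE (Lcoord lam)) average_gen linearZ linear_sum /=.
rewrite (eq_bigr (fun=> Lcoord lam (fgen m v))) => [|g _].
  by rewrite sumr_const -scaler_nat scalerA mulVf // scale1r.
by rewrite -(Lcoord_balance HF) -mulgA mulVval -val_maxgrp1 (Lcoord_balance HF) act1v.
Qed.

(** A total version of a map defined on the kernel of the cover. Its values off
    the kernel depend on a choice of complement; only those on it matter. *)
Definition on_ker (h : 'Hom(N, Coind W)) : 'Hom(F, Coind W) :=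
  (h \o linfun (vsproj (lker p)))%VF.

Lemma on_kerE h z : on_ker h z = h (vsproj (lker p) z).
Proof. by rewrite /on_ker (comp_lfunE h) linfun_vsprojE. Qed.

Lemma on_ker_val h (z : N) : on_ker h (vsval z) = h z.
Proof. by rewrite on_kerE vsvalK. Qed.

Lemma on_ker_act h m z : is_hom h -> p z = 0 ->
  on_ker h (act m z) = act m (on_ker h z).
Proof.
move=> hh pz; rewrite !on_kerE -hh; congr (h _); apply/val_inj.
have zK : z \in lker p by rewrite memv_ker pz.
rewrite [RHS]sub_actE /= !vsprojK // memv_ker cover_hom pz; apply/eqP; exact: linear0.
Qed.

(** An element of Coind W is recovered from the values at f of its translates. *)
Lemma coev_f r (s : Coind W) : (idval f * r)%g = r -> coev (idval f) (act r s) = coev r s.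
Proof. by move=> fr; rewrite coev_act ?fr // inE. Qed.

(** Vanishing of Ext^1(L (x)_{kG} V, Coind W). The extension is defined
    separately on both summands of kM (x) V cut out by the averaging projector:
    on the kernel of average, which is contained in that of cover, it is h; on
    the image it is induced by psi : V -> Coind W, which has the value of h (r (x) v)
    at f when r in R_f is in Me but not in Ltilde_e, and 0 for other r. *)
Lemma extend_hom (h : 'Hom(N, Coind W)) : is_hom h ->
  exists2 h' : 'Hom(F, Coind W), is_hom h' &
    forall z : N, B (vsval z) -> h' (vsval z) = h z.
Proof.
move=> hh; pose hp := on_ker h.
have pgen m v : (m * idval e)%g = m -> m \notin Lt -> p (fgen m v) = 0.
  by move=> me mL; apply: (cover_Lnull HF) => //; apply: (Lnull_gen HF).
pose T r : 'Hom(V, W) := if ((r * idval e)%g == r) && (r \notin Lt)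
  then (coev (idval f) \o (hp \o linfun (fgen r)))%VF else 0.
have TE r v : (r * idval e)%g = r -> r \notin Lt -> T r v = coev (idval f) (hp (fgen r v)).
  by move=> re rL; rewrite /T re eqxx rL /= (comp_lfunE (coev _)) (comp_lfunE hp) (lfunE (fgen r)).
have T0 r v : (r * idval e)%g <> r \/ r \in Lt -> T r v = 0.
  rewrite /T; case: eqP => [re [//|->]|_ _]; exact: zero_lfunE.
have [psi psiE] : exists i : 'Hom(V, Coind W),
    forall v r, r \in Rf -> coev r (i v) = T r v.
  apply: coind_lift => g r v rR.
  have fr := Rclass_idl rR.
  have gK : (val g^-1 * (val g * r))%g = r by rewrite mulgA mulVval.
  have [re|re] := eqVneq (r * idval e)%g r; last first.
    rewrite !T0 ?linear0 //; left; first exact/eqP.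
    move=> gre; case/eqP: re; have := congr1 (fun x : M => (val g^-1 * x)%g) gre.
    by rewrite /= gK mulgA gK.
  have gre : (val g * r * idval e)%g = (val g * r)%g by rewrite -mulgA re.
  have [rL|rL] := boolP (r \in Lt).
    rewrite !T0 ?linear0 //; right => //.
    by apply: (Ltilde_cancel (m := val g^-1%g)); rewrite ?gK.
  have grL : (val g * r)%g \notin Lt.
    by apply: contra rL; apply: Ltilde_cancel.
  rewrite !TE // -act_fgen (on_ker_act _ hh) ?pgen //.
  rewrite coev_f ?(val_maxgrp_id g).1 // -coev_grp ?inE //.
  by rewrite (val_maxgrp_id g).2.
pose h0 : 'Hom(F, Coind W) := free_lift psi.
have h0E m v : (m * idval e)%g = m -> m \notin Lt -> h0 (fgen m v) = hp (fgen m v).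
  have h0g : h0 (fgen m v) = act m (psi v) by apply: free_liftE.
  move=> me mL; apply: coev_ext => r rR.
  have fr := Rclass_idl rR.
  have rme : (r * m * idval e)%g = (r * m)%g by rewrite -mulgA me.
  have rmL : (r * m)%g \notin Lt by apply: contra mL; apply: Ltilde_cancel.
  rewrite h0g coev_act //.
  rewrite -(coev_f (hp _) fr) -(on_ker_act _ hh) ?pgen // act_fgen.
  have [rmR|rmR] := boolP ((r * m)%g \in Rf); first by rewrite psiE // TE.
  rewrite coev_notin //; set x := (r * m)%g in rme rmL rmR *.
  have fx : (idval f * x)%g = x by rewrite mulgA fr.
  (* The right Fountain property: x = x b with b an idempotent in Me. *)
  have [b ib bx] := HF x; move: (bx); rewrite inE => /ltildeP bxP.
  have xb : (x * b)%g = x by apply/(bxP b ib); apply/eqP.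
  have be : (b * idval e)%g = b by apply/(bxP _ (idemP e)).
  have bL : b \notin Lt.
    apply: contra rmL; rewrite !inE => /ltildeP bLP; apply/ltildeP=> a ia.
    by rewrite -(bxP a ia) (bLP a ia).
  rewrite -{1}xb -act_fgen (on_ker_act _ hh) ?pgen // coev_f // coev_notin //.
(* The kernel of average lies in that of the cover, where h itself is available. *)
pose h' := (on_ker h \o (\1 - average V) + (h0 \o average V))%VF.
have h'E z : h' z = on_ker h (z - average V z) + h0 (average V z).
  rewrite /h' add_lfunE (comp_lfunE (on_ker h)) (comp_lfunE h0).
  by rewrite add_lfunE opp_lfunE id_lfunE.
have p1 z : p (z - average V z) = 0.
  by apply: (cover_Lnull HF) => //; apply: Lnull_sub => lam; rewrite Lcoord_average.
have pi_hom : is_hom (average V) by apply: average_hom.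
exists h' => [m z|z Bz].
  rewrite !h'E [RHS]linearD /= -(on_ker_act m hh (p1 z)) pi_hom -linearB; congr (_ + _).
  exact: (@free_lift_hom k M V (Coind W) psi m (average V z)).
rewrite h'E (_ : h0 (average V (vsval z)) = on_ker h (average V (vsval z))).
  by rewrite -linearD /= subrK on_ker_val.
rewrite (average_Lnull HF Bz) !linear_sum; apply: eq_bigr => y /andP[/eqP ye yL].
exact: h0E.
Qed.
End Relative.

(** * Homomorphisms on the radical and the layer at f *)

(** Curries a bilinear map into nested spaces of linear maps. *)
Lemma bilinear_lfun (k : fieldType) (A C D : vectType k) (T : A -> C -> D) :
  (forall c, linear (T^~ c)) -> (forall a, linear (T a)) ->
  exists Phi : 'Hom(A, 'Hom(C, D)), forall a c, Phi a c = T a c.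
Proof.
move=> Tl Tr.
pose TaL a := GRing.isSemilinear.Build k C D *:%R (T a)
  (GRing.semilinear_linear (Tr a)).
pose Ta a : {linear C -> D} := HB.pack (T a) (TaL a).
pose P a : 'Hom(C, D) := linfun (Ta a).
have PE a c : P a c = T a c by rewrite /P lfunE.
have Pl : linear P.
  by move=> c a a'; apply/lfunP=> x; rewrite add_lfunE scale_lfunE !PE Tl.
pose PL := GRing.isSemilinear.Build k A 'Hom(C, D) *:%R P (GRing.semilinear_linear Pl).
pose Pf : {linear A -> 'Hom(C, D)} := HB.pack P PL.
by exists (linfun Pf) => a c; rewrite (lfunE Pf) PE.
Qed.

Section Layers.
Variables (k : fieldType) (M : finMonoidType) (e f : idem M).
Hypothesis HF : right_fountain M.
Variables (V : kmod k (maxgrp e)) (W : kmod k (maxgrp f)).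
Hypothesis G_unit : #|{: maxgrp e}|%:R != 0 :> k.
Hypothesis simpleC : simple_mod (Coind V).

Local Notation G := (maxgrp e).
Local Notation L := (Ltilde_mod k e).
Local Notation Rf := (Rclass (idval f)).
Local Notation F := (free_mod M V).
Local Notation B := (@Lnull k M e V).
Local Notation p := (cover V).
Local Notation N := (ker_mod (@cover_hom k M e V)).
Local Notation Q := (rad_layer k HF e f).
Local Notation fR := (f_rad_mod k HF e f).
Local Notation X := (hom_bimod W V).
Implicit Types (z : F) (m r : M) (h : 'Hom(N, Coind W)) (x : L).

Definition layer_proj : 'Hom(fR, Q) := quo_proj (fI_rad_sub k HF e f).
(** The representative in L, inside f rad L, of a class in the layer. *)
Definition layer_val (q : Q) : L := vsval (vsval q : fR).

Lemma f_radP x : x \in f_rad k e f -> x \in rad L /\ act (idval f) x = x.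
Proof.
case/memv_imgP=> y yR ->; split; last by rewrite -actMv idemE.
by apply: submod_act => //; apply: rad_submod.
Qed.

Lemma mem_f_rad r x : (idval f * r)%g = r -> x \in rad L -> act r x \in f_rad k e f.
Proof.
move=> fr xR; rewrite -fr actMv; apply: memv_img; apply: submod_act => //.
exact: rad_submod.
Qed.

Lemma mem_fI_rad r x : (idval f * r)%g = r -> r \in nonabove f -> x \in rad L ->
  act r x \in fI_rad k e f.
Proof.
move=> fr rI xR; rewrite -fr actMv; apply: memv_img.
by apply: (subvP (sumv_sup r rI (subvv _))); apply: memv_img.
Qed.

Lemma layer_val_f_rad q : layer_val q \in f_rad k e f.
Proof. exact: subvsP. Qed.

Lemma layer_val_proj (y : fR) : vsval y - layer_val (layer_proj y) \in fI_rad k e f.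
Proof.
have := quo_projB (fI_rad_sub k HF e f) y.
by rewrite -memv_preim linfun_vsvalE.
Qed.

Lemma layer_projK (q : Q) : layer_proj (vsval q) = q.
Proof. exact: quo_proj_val. Qed.

Lemma val_fR_act (g : maxgrp f * maxgrp e) (y : fR) :
  vsval (act g y) = layer_act k g (vsval y) :> L.
Proof. by rewrite restrE // layer_stable. Qed.

Lemma layer_proj_act g (y : fR) : layer_proj (act g y) = act g (layer_proj y).
Proof. exact: (quo_proj_hom (@fI_rad_submod k M HF e f)). Qed.

Section Killing.
Variable h : 'Hom(N, Coind W).
Hypotheses (hh : is_hom h) (hB : forall z : N, B (vsval z) -> h z = 0).
Local Notation hp := (on_ker h).

Lemma on_ker_Lnull z : B z -> hp z = 0.
Proof.
move=> Bz; rewrite on_kerE hB // vsprojK // memv_ker.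
by apply/eqP; apply: (cover_Lnull HF).
Qed.

Lemma on_ker_eq z z' : (forall lam, Lcoord lam z = Lcoord lam z') -> hp z = hp z'.
Proof.
move=> eqz; apply/eqP; rewrite -subr_eq0 -linearB; apply/eqP.
by apply: on_ker_Lnull; apply: Lnull_sub.
Qed.

Lemma on_ker_pure m v x : x \in rad L -> hp (pure v (act m x)) = act m (hp (pure v x)).
Proof.
move=> xR; rewrite -on_ker_act //; last exact: cover_pure.
by apply: on_ker_eq => lam; apply: Lcoord_pure_act.
Qed.

(** The value at f of f m s is the value of s at f m, which is not in R_f when
    m is in I(f). *)
Lemma coev_fI v x : x \in fI_rad k e f -> coev (idval f) (hp (pure v x)) = 0.
Proof.
case/memv_imgP=> y /memv_sumP[w wR ->] ->.
rewrite !linear_sum big1 // => m mI /=.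
have /memv_imgP[x' x'R ->] := wR m mI.
rewrite -[Ltilde_act k e f _]/(act (idval f) (act m x' : L)).
rewrite -actMv on_ker_pure // coev_f ?mulgA ?idemE // coev_notin //; apply: contraL mI => fmR.
have /nonaboveP[a [b afm]] := Rclass_above fmR.
by apply/nonaboveP; exists (a * idval f)%g, b; rewrite -(mulgA a).
Qed.

Lemma coev_layer_val v (y : fR) :
  coev (idval f) (hp (pure v (layer_val (layer_proj y)))) = coev (idval f) (hp (pure v (vsval y))).
Proof.
apply/esym/eqP; rewrite -subr_eq0 -!linearB /= ; apply/eqP/coev_fI.
exact: layer_val_proj.
Qed.

Lemma coev_layer (g : maxgrp f * maxgrp e) v x : x \in f_rad k e f ->
  coev (idval f) (hp (pure v (layer_act k g x))) =
  act g.1 (coev (idval f) (hp (pure (act (g.2^-1)%g v) x))).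
Proof.
move=> xF; have [xR fx] := f_radP xF.
rewrite (layer_actC HF) ract_comm //.
have rxR : Ltilde_ract k e (val (g.2^-1)%g) x \in rad L.
  by apply: (subvP (Ltilde_ract_rad k HF _)); apply: memv_img.
rewrite on_ker_pure // coev_f ?(val_maxgrp_id _).1 //.
rewrite -coev_grp ?inE // (val_maxgrp_id _).2; congr (coev _ _).
by apply: on_ker_eq => lam; apply: Lcoord_pure_ract.
Qed.
End Killing.

(** The map realizing the bijection: h is sent to the values at f of
    h (x (x) v), for x in f rad L. *)
Lemma layer_map_ex :
  exists Phi : 'Hom('Hom(N, Coind W), 'Hom(Q, 'Hom(V, W))),
    forall h q v, Phi h q v = coev (idval f) (on_ker h (pure v (layer_val q))).
Proof.
have [R RE] : exists R : 'Hom(L, 'Hom(V, F)), forall x v, R x v = pure v x.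
  by apply: bilinear_lfun => [v|x]; [move=> c x x'; apply: linearP | apply: pure_linear].
have [Phi PhiE] : exists Phi : 'Hom('Hom(N, Coind W), 'Hom(Q, 'Hom(V, W))),
    forall h q, Phi h q = (coev (idval f) \o (on_ker h \o R (layer_val q)))%VF.
  apply: bilinear_lfun => [q c h h'|h c q q']; apply/lfunP=> v.
    rewrite (add_lfunE (c *: _)) (scale_lfunE c) !(comp_lfunE (coev _)).
    rewrite (comp_lfunE (on_ker (c *: h + h'))) (comp_lfunE (on_ker h)).
    rewrite (comp_lfunE (on_ker h')) !on_kerE (add_lfunE (c *: h)) (scale_lfunE c h).
    exact: linearP.
  rewrite (add_lfunE (c *: _)) (scale_lfunE c) !(comp_lfunE (coev _)).
  rewrite !(comp_lfunE (on_ker h)) /layer_val !RE.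
  by rewrite -!linearP.
exists Phi => h q v.
by rewrite PhiE (comp_lfunE (coev _)) (comp_lfunE (on_ker h)) RE.
Qed.

Section Lift.
Variable gam : 'Hom(Q, X).
Hypothesis hgam : is_hom gam.

(** A homomorphism from the layer, read as a linear map on all of L through a
    projection onto f rad L. *)
Definition radlift : 'Hom(L, 'Hom(V, W)) :=
  (gam \o layer_proj \o linfun (vsproj (f_rad k e f)))%VF.

Lemma radliftE x : radlift x = gam (layer_proj (vsproj (f_rad k e f) x)).
Proof.
by rewrite /radlift -comp_lfunA (comp_lfunE gam) (comp_lfunE layer_proj) linfun_vsprojE.
Qed.

Lemma radlift_act g x v : x \in f_rad k e f ->
  radlift (layer_act k g x) v = act g.1 (radlift x (act (g.2^-1)%g v)).
Proof.
move=> xF; rewrite !radliftE.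
have -> : vsproj (f_rad k e f) (layer_act k g x) = act g (vsproj (f_rad k e f) x : fR).
  apply/val_inj; rewrite /= val_fR_act !vsprojK //.
  by apply: (subvP (layer_stable k HF g)); apply: memv_img.
by rewrite layer_proj_act hgam hom_bimodE.
Qed.

Lemma radlift_fI x : x \in fI_rad k e f -> radlift x = 0.
Proof.
move=> xI; rewrite radliftE.
have xF : x \in f_rad k e f.
  apply: (subvP _ x xI); apply: limgS; apply/subv_sumP=> m _.
  exact: (@rad_submod k M L m).
rewrite (_ : layer_proj _ = 0) ?linear0 //; apply/eqP; rewrite -memv_ker quo_proj_ker.
by rewrite -memv_preim linfun_vsvalE vsprojK.
Qed.

Lemma radlift_left (g : maxgrp f) x v : x \in f_rad k e f ->
  radlift (act (val g) x) v = act g (radlift x v).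
Proof.
move=> xF; have := radlift_act (g, 1%g) v xF; rewrite (layer_actC HF) /= invg1 act1v.
by rewrite Ltilde_ract1 id_lfunE.
Qed.

Lemma radlift_right (g : maxgrp e) x v : x \in f_rad k e f ->
  radlift (Ltilde_ract k e (val g) x) v = radlift x (act g v).
Proof.
move=> xF; have := radlift_act (1%g, g^-1%g) v xF; rewrite (layer_actC HF) /= invgK act1v.
by rewrite (f_radP xF).2.
Qed.

(** Inverts layer_map_ex: the value of h z at r is the sum over a basis v_j of V
    of gam (r x_j) v_j, where x_j in rad L is the j-th coordinate of z. This is
    M-linear because r m x_j is in f I(f) rad L when r m leaves R_f. *)
Lemma lift_layer_map : exists h : 'Hom(N, Coind W),
  [/\ is_hom h, forall z : N, B (vsval z) -> h z = 0 &
      forall q v, coev (idval f) (on_ker h (pure v (layer_val q))) = (gam q : 'Hom(V, W)) v].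
Proof.
pose T r z : W := \sum_j radlift (act r (Lcoord (dualb j) z)) (basv j).
have Tl r : linear (T r \o @vsval _ _ (lker p)).
  move=> c z z' /=; rewrite /T scaler_sumr -big_split; apply: eq_bigr => j _ /=.
  by rewrite !linearP add_lfunE scale_lfunE.
pose TL r := GRing.isSemilinear.Build k N W *:%R _ (GRing.semilinear_linear (Tl r)).
pose Tf r : {linear N -> W} := HB.pack (T r \o @vsval _ _ (lker p)) (TL r).
have xlN (z : N) j : Lcoord (dualb j) (vsval z) \in rad L.
  apply: (Lcoord_rad HF); apply/eqP; rewrite -memv_ker; exact: subvsP.
have [h hE] : exists h : 'Hom(N, Coind W),
    forall (z : N) r, r \in Rf -> coev r (h z) = T r (vsval z).
  have [h hE] : exists h : 'Hom(N, Coind W),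
      forall (z : N) r, r \in Rf -> coev r (h z) = linfun (Tf r) z.
    apply: coind_lift => g r z rR; rewrite !lfunE /= /T linear_sum.
    apply: eq_bigr => j _; rewrite actMv radlift_left //.
    by apply: mem_f_rad; [exact: Rclass_idl rR | exact: xlN].
  by exists h => z r rR; rewrite hE // lfunE.
exists h; split.
- move=> m z; apply: coev_ext => r rR; rewrite hE // coev_act //.
  have -> : T r (vsval (act m z)) = T (r * m)%g (vsval z).
    rewrite /T; apply: eq_bigr => j _.
    by rewrite [vsval _]sub_actE Lcoord_hom -actMv.
  have [rmR|rmR] := boolP ((r * m)%g \in Rf); first by rewrite hE.
  have frm : (idval f * (r * m))%g = (r * m)%g by rewrite mulgA (Rclass_idl rR).
  rewrite coev_notin // /T big1 // => j _; rewrite radlift_fI ?zero_lfunE //.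
  apply: mem_fI_rad; [by [] | | exact: xlN].
  by apply: contraNT rmR; apply: mem_Rclass.
- move=> z Bz; apply: coev_inj => r rR; rewrite hE // /T big1 // => j _.
  by rewrite Bz !linear0 zero_lfunE.
move=> q v; have xF := layer_val_f_rad q; have [xR fx] := f_radP xF.
rewrite on_kerE hE ?inE // vsprojK; last by rewrite memv_ker cover_pure.
rewrite /T; transitivity (radlift (layer_val q) v); last first.
  by rewrite radliftE /layer_val vsvalK layer_projK.
under eq_bigr => j _ do rewrite (Lcoord_pure HF) linearZ linear_sum /= linearZ linear_sum /=.
under eq_bigr => j _ do rewrite scale_lfunE sum_lfunE.
rewrite -scaler_sumr exchange_big /= (eq_bigr (fun=> radlift (layer_val q) v)) => [|g _].
  by rewrite sumr_const -scaler_nat scalerA mulVf // scale1r.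
(* The g-summand equals radlift (layer_val q) v, by moving g across with radlift_right. *)
rewrite -[v in RHS]act1v -(mulVg g) actMv [act g v in RHS]basv_sum !linear_sum.
apply: eq_bigr => j _; rewrite !linearZ /= scale_lfunE; congr (_ *: _).
by rewrite -ract_comm // fx radlift_right.
Qed.
End Lift.

(** Injectivity: an element of the kernel of the cover is, modulo Lnull, a sum of
    tensors x (x) v with x in rad L, and h (x (x) v) is determined by the values at
    f of h (r x (x) v) for r in R_f, where r x lies in f rad L. *)
Lemma dim_killing_homs :
  \dim (killing_homs (Coind W) (fun z : N => B (vsval z))) = \dim (homs Q X).
Proof.
have [Phi PhiE] := layer_map_ex; apply: (dim_bij (f := Phi)).
- move=> h /memv_killing_homs[hh hB]; apply/(@memv_homs _ _ Q X) => g q.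
  apply/lfunP=> v; rewrite hom_bimodE -[q in LHS]layer_projK -layer_proj_act !PhiE.
  rewrite coev_layer_val // val_fR_act coev_layer //; exact: subvsP.
- move=> h /memv_killing_homs[hh hB] Ph0; apply/lfunP=> z; rewrite zero_lfunE.
  have zK : p (vsval z) = 0 by apply/eqP; rewrite -memv_ker; apply: subvsP.
  rewrite -on_ker_val (on_ker_eq hB (z' := from_coords (vsval z))); last first.
    by move=> lam; rewrite (Lcoord_from_coords HF).
  rewrite /from_coords linear_sum big1 // => j _ /=.
  set x := Lcoord _ _; have xR : x \in rad L by apply: (Lcoord_rad HF).
  apply: coev_inj => r rR; have fr := Rclass_idl rR.
  rewrite -coev_f // -on_ker_pure //.
  have rxF : act r x \in f_rad k e f by apply: mem_f_rad.
  have <- : vsval (vsproj (f_rad k e f) (act r x) : fR) = act r x by rewrite vsprojK.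
  by rewrite -coev_layer_val // -PhiE Ph0 !zero_lfunE.
move=> gam /(@memv_homs _ _ Q X) hgam; have [h [hh hB hE]] := lift_layer_map hgam.
exists h; first exact/memv_killing_homs.
by apply/lfunP=> q; apply/lfunP=> v; rewrite PhiE hE.
Qed.
End Layers.

Lemma natr_card_unit (k : fieldType) (T : finType) :
  (0 < #|T|)%N -> (forall q, q \in [pchar k] -> ~~ (q %| #|T|)%N) -> #|T|%:R != 0 :> k.
Proof.
move=> T0 Tq; apply/negP=> T00; have [q qk] := natf0_pchar T0 T00.
by have := Tq q qk; rewrite (dvdn_pcharf qk) T00.
Qed.

Theorem theorem5p3 (k : fieldType) (M : finMonoidType)
    (HF : right_fountain M)
    (Hchar : forall (a : idem M) (p : nat),
        p \in [pchar k]%R -> ~~ (p %| #|{: maxgrp a}|)%N)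
    (Hsplit : forall a : idem M, splitting_field k (maxgrp a))
    (Hcoind : forall (a : idem M) (Y : kmod k (maxgrp a)),
        simple_mod Y -> simple_mod (Coind Y))
    (e f : idem M)
    (W : kmod k (maxgrp f)) (hW : simple_mod W)
    (V : kmod k (maxgrp e)) (hV : simple_mod V) :
  quiver_arrows (Coind V) (Coind W) = mult (tensD W V) (rad_layer k HF e f).
Proof.
have unitG (a : idem M) : #|{: maxgrp a}|%:R != 0 :> k.
  apply: natr_card_unit; last exact: Hchar.
  by apply/card_gt0P; exists 1%g.
have sCV := Hcoind e V hV.
rewrite /quiver_arrows (dim_ext1_relative (hp := @cover_hom k M e V)
  (B := @Lnull k M e V)).
- rewrite dim_killing_homs // (mult_iso _ (tensD_hom_bimod W V)).
  apply: dim_homs_mult; last first.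
    exact: (hom_bimod_abs_simple (Hsplit f) (Hsplit e) hW hV).
  by rewrite card_prod natrM mulf_neq0 ?unitG.
- exact: cover_surj.
- exact: extend_hom.
move=> h hh hB; apply: (rigidity HF) => //; first exact: Hcoind.
by move=> z Bz; apply: hB => //; apply: (cover_Lnull HF).
Qed.
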